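(* Let $(M,F)$ be a conic pseudo-Finsler surface with $F$ defined on the conic sub-bundle $\mathcal A$, let $\phi:\mathcal A\to\mathbb R$ be a smooth function positively homogeneous of degree $0$ in $y$ with $\sigma+\varepsilon-(\phi_{;2})^2\neq0$ on $\mathcal A$, where $\sigma=\phi_{;2;2}+\varepsilon\mathcal I\phi_{;2}+2(\phi_{;2})^2$, and let $\overline F=e^{\phi}F$. Let $S$ and $\overline S$ be the geodesic sprays of $F$ and $\overline F$. Then the following assertions are equivalent: (i) $\overline S=S$, that is, $P=Q=0$, where with $\rho=1/(\sigma+\varepsilon-(\phi_{;2})^2)$, $$2Q=\varepsilon\rho F^2(\phi_{;2}\phi_{,1}+\phi_{,1;2}-2\phi_{,2}),\qquad 2P=-\rho F^2\phi_{;2}(\phi_{;2}\phi_{,1}+\phi_{,1;2}-2\phi_{,2})+F^2\phi_{,1};$$ (ii) $\delta_i\phi=0$ for $i=1,2$.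
   Context: Let $M$ be a smooth 2-dimensional manifold, $(x^1,x^2)$ local coordinates and $(x^i,y^i)$ the induced coordinates on $TM$; all formulas are in such a coordinate system and repeated indices are summed over $\{1,2\}$. Write $\partial_i=\partial/\partial x^i$, $\dot\partial_i=\partial/\partial y^i$. A function is $h(r)$ if it is positively homogeneous of degree $r$ in $y$. A conic sub-bundle is a non-empty open subset $\mathcal A\subset TM\setminus 0$ projecting onto $M$ and closed under multiplication by positive scalars. A conic pseudo-Finsler metric on $M$ is a smooth $h(1)$ function $F:\mathcal A\to\mathbb R$ such that $g_{ij}=\tfrac12\dot\partial_i\dot\partial_jF^2$ is non-degenerate at each point of $\mathcal A$; $(g^{ij})$ is the inverse matrix. A conic pseudo-Finsler surface is equipped with its modified Berwald frame: $F$ is nowhere zero on $\mathcal A$, $\ell_i=\dot\partial_iF$, $\ell^i=y^i/F$, $\varepsilon\in\{1,-1\}$ (the signature) is the sign of $\det(g_{ij})$, $m_1=-\sqrt{\varepsilon\det(g_{ij})}\,\ell^2$, $m_2=\sqrt{\varepsilon\det(g_{ij})}\,\ell^1$, $m^i=g^{ij}m_j$; thus $g_{ij}=\ell_i\ell_j+\varepsilon m_im_j$, $\ell^im_i=0$, $m^im_i=\varepsilon$. The main scalar $\mathcal I$ is defined by $F\,C_{ijk}=\mathcal I\,m_im_jm_k$, where $C_{ijk}=\tfrac12\dot\partial_kg_{ij}$. The geodesic spray of $F$ is $S=y^i\partial_i-2G^i\dot\partial_i$ with $G^i=\tfrac14g^{ij}(y^k\dot\partial_j\partial_kF^2-\partial_jF^2)$;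 $G^j_i=\dot\partial_iG^j$ and $\delta_i=\partial_i-G^j_i\dot\partial_j$. The geodesic spray $\overline S$ of $\overline F$ is defined in the same way from $\overline F$ (the condition $\sigma+\varepsilon-(\phi_{;2})^2\ne0$ guarantees that $\overline F$ is a conic pseudo-Finsler metric). For a smooth function $f$ on $\mathcal A$: $f_{;2}:=\varepsilon F(\dot\partial_if)m^i$, $f_{,1}:=(\delta_if)\ell^i$, $f_{,2}:=\varepsilon(\delta_if)m^i$, and iterated symbols are read left to right, e.g. $f_{;2;2}=(f_{;2})_{;2}$, $f_{,1;2}=(f_{,1})_{;2}$. *)

(* Defs.v *)
From HB Require Import structures.
From mathcomp Require Import all_boot all_order all_algebra.
From mathcomp Require Import all_classical all_reals all_analysis.

Set Implicit Arguments.
Unset Strict Implicit.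
Unset Printing Implicit Defensive.

Import Order.TTheory GRing.Theory Num.Theory.
Import numFieldNormedType.Exports.

Local Open Scope classical_set_scope.
Local Open Scope ring_scope.

(* For an open set U, f is smooth_on U iff f is C^oo on U: every iterated
   directional derivative of f exists and is continuous at each point of U. *)
Definition smooth_on (R : realType) (V W : normedModType R)
    (U : set V) (f : V -> W) : Prop :=
  forall (s : seq V) (z : V), U z ->
    let g := foldr (fun v h => 'D_v h) f s in
    {for z, continuous g} /\ forall v, derivable g z v.

(* Smooth 2-dimensional manifolds, presented by a smooth atlas.  The map
   [param i] is the inverse of the chart [coord i]; the values of [coord i]
   outside [dom i], and of [param i] outside the image, are irrelevant. *)
Record smooth_surface (R : realType) (M : topologicalType) : Type := {
  chart : Type;
  dom : chart -> set M;
  coord : chart -> M -> 'rV[R]_2;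
  param : chart -> 'rV[R]_2 -> M;
  surface_hausdorff : hausdorff_space M;
  surface_countable : @second_countable M;
  dom_cover : forall p, exists i, dom i p;
  dom_open : forall i, open (dom i);
  coord_open : forall i, open (coord i @` dom i);
  coordK : forall i, {in dom i, cancel (coord i) (param i)};
  coord_continuous : forall i, {within dom i, continuous (coord i)};
  param_continuous : forall i,
    {within coord i @` dom i, continuous (param i)};
  transition_smooth : forall i j,
    smooth_on (coord i @` (dom i `&` dom j)) (coord j \o param i) }.

Section TangentBundle.
Variables (R : realType) (M : topologicalType) (X : smooth_surface R M).

Definition TV : normedModType R := ('rV[R]_2 * 'rV[R]_2)%type.

(* A subset of TM, or a function on it, is given by its expressions in the
   induced coordinates z = (x, y) of all the charts; these expressions must
   agree under the changes of induced coordinates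
   (x, y) |-> (tau x, d tau_x y). *)
Definition overlap (i j : chart X) : set 'rV[R]_2 :=
  coord i @` (dom i `&` dom j).

Definition tangent_change (i j : chart X) (z : TV) : TV :=
  ((coord j \o param i) z.1, 'D_(z.2) (coord j \o param i) z.1).

Definition tangent_set (A : chart X -> set TV) : Prop :=
  (forall i z, A i z -> (coord i @` dom i) z.1) /\
  (forall i j z, overlap i j z.1 -> (A j (tangent_change i j z) <-> A i z)).

Definition tangent_fun (A : chart X -> set TV) (f : chart X -> TV -> R) :
    Prop :=
  forall i j z, A i z -> overlap i j z.1 -> f j (tangent_change i j z) = f i z.

Definition conic_subbundle (A : chart X -> set TV) : Prop :=
  [/\ tangent_set A,
      (exists i, A i !=set0) /\ (forall i, open (A i)),
      (forall i z, A i z -> z.2 != 0),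
      (forall p, exists i y, dom i p /\ A i (coord i p, y)) &
      (forall i z (t : R), 0 < t -> A i z -> A i (z.1, t *: z.2))].

Definition smooth_fun (A : chart X -> set TV) (f : chart X -> TV -> R) :
    Prop :=
  tangent_fun A f /\ forall i, smooth_on (A i) (f i).

Definition homogeneous (r : nat) (A : chart X -> set TV)
    (f : chart X -> TV -> R) : Prop :=
  forall i z (t : R), 0 < t -> A i z -> f i (z.1, t *: z.2) = t ^+ r * f i z.

End TangentBundle.

(* Formulas in one system of induced coordinates; the coordinate indices 1, 2
   are the elements 0, 1 of 'I_2. *)
Section LocalFormulas.
Variable R : realType.
Local Notation V := (TV R).
Implicit Types (F f phi I : V -> R) (z : V) (i j k : 'I_2).

Definition dx i f z : R := 'D_((delta_mx 0 i, 0) : V) f z.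
Definition dy i f z : R := 'D_((0, delta_mx 0 i) : V) f z.

Definition metric F z : 'M[R]_2 :=
  \matrix_(i, j) (2^-1 * dy i (dy j (fun w => F w ^+ 2)) z).

Definition metric_inv F z : 'M[R]_2 := invmx (metric F z).

Definition ell_lo F i z : R := dy i F z.
Definition ell_up F i z : R := z.2 0 i / F z.

(* The signature, as a locally constant function on the domain of F. *)
Definition eps F z : R := Num.sg (\det (metric F z)).

Definition m_lo F i z : R :=
  let s := Num.sqrt (eps F z * \det (metric F z)) in
  if i == 0 then - s * ell_up F 1 z else s * ell_up F 0 z.
Definition m_up F i z : R := \sum_j metric_inv F z i j * m_lo F j z.

Definition cartan F i j k z : R := 2^-1 * dy k (fun w => metric F w i j) z.

Definition is_main_scalar (A : set V) F I : Prop :=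
  forall z, A z -> forall i j k,
    F z * cartan F i j k z = I z * m_lo F i z * m_lo F j z * m_lo F k z.

Definition spray_coef F i z : R :=
  4^-1 * \sum_j metric_inv F z i j *
    (\sum_k z.2 0 k * dy j (dx k (fun w => F w ^+ 2)) z
     - dx j (fun w => F w ^+ 2) z).

(* The components of S in the frame (d/dx^i, d/dy^i). *)
Definition geodesic_spray F z : V := (z.2, \row_i (- 2 * spray_coef F i z)).

(* [connection F i j] is G^j_i. *)
Definition connection F i j z : R := dy i (spray_coef F j) z.

Definition delta F i f z : R :=
  dx i f z - \sum_j connection F i j z * dy j f z.

(* f_{;2}, f_{,1} and f_{,2}. *)
Definition semi2 F f z : R := eps F z * F z * \sum_i dy i f z * m_up F i z.
Definition comma1 F f z : R := \sum_i delta F i f z * ell_up F i z.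
Definition comma2 F f z : R := eps F z * \sum_i delta F i f z * m_up F i z.

Definition sigma F I phi z : R :=
  semi2 F (semi2 F phi) z + eps F z * I z * semi2 F phi z
  + 2 * semi2 F phi z ^+ 2.

Definition rho F I phi z : R :=
  1 / (sigma F I phi z + eps F z - semi2 F phi z ^+ 2).

Definition PQ_factor F phi z : R :=
  semi2 F phi z * comma1 F phi z + semi2 F (comma1 F phi) z
  - 2 * comma2 F phi z.

Definition Qcoef F I phi z : R :=
  2^-1 * (eps F z * rho F I phi z * F z ^+ 2 * PQ_factor F phi z).

Definition Pcoef F I phi z : R :=
  2^-1 * (- rho F I phi z * F z ^+ 2 * semi2 F phi z * PQ_factor F phi z
          + F z ^+ 2 * comma1 F phi z).

Definition anisotropic_change F phi z : R := expR (phi z) * F z.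

End LocalFormulas.

Section Finsler.
Variables (R : realType) (M : topologicalType) (X : smooth_surface R M).

Definition conic_pseudo_Finsler (A : chart X -> set (TV R))
    (F : chart X -> TV R -> R) : Prop :=
  [/\ smooth_fun A F, homogeneous 1 A F &
      forall i z, A i z -> metric (F i) z \in unitmx].

End Finsler.

(* Main.v *)
(* Put L = F^2 and let S be the geodesic spray of F.  For a function K on the
   cone, homogeneous of degree 1, S is the geodesic spray of K as soon as K^2
   solves the Euler-Lagrange equations along S and the metric of K is
   invertible.  Those equations read d(S K^2)/dy^i = 2 delta_i K^2;
   contracting with y^i, Euler's theorem gives 3 S K^2 = 2 S K^2, so that they
   are equivalent to delta_i K^2 = 0.  Apply this to F and to
   Fbar = e^phi F: since delta_i L = 0, one has
   delta_i Fbar^2 = 2 Fbar^2 delta_i phi, hence the sprays agree iff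
   delta_i phi = 0.  The metric of Fbar is invertible because its Gram
   determinant on the frame (y, m) is
   e^(4 phi) F^2 (sigma + eps - (phi_;2)^2).  Finally P = Q = 0 means
   phi_,1 = 0 and phi_,1;2 = 2 phi_,2; the first equation, valid on an open
   set, turns the second into phi_,2 = 0. *)

Require Import Defs.
From HB Require Import structures.
From mathcomp Require Import all_boot all_order all_algebra.
From mathcomp Require Import all_classical all_reals all_analysis.
From mathcomp Require Import ring lra.

Set Implicit Arguments.
Unset Strict Implicit.
Unset Printing Implicit Defensive.

Import Order.TTheory GRing.Theory Num.Theory.
Import numFieldNormedType.Exports.

Local Open Scope classical_set_scope.
Local Open Scope ring_scope.

(** * Directional derivatives *)

Section DirectionalDerivatives.
Context {R : realType} {V : normedModType R}.
Implicit Types (f g : V -> R) (z u v : V).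

Lemma is_derive_add f g z v a b : is_derive z v f a -> is_derive z v g b ->
  is_derive z v (fun w => f w + g w) (a + b).
Proof. by move=> fa gb; exact: is_deriveD. Qed.

Lemma is_derive_opp f z v a : is_derive z v f a ->
  is_derive z v (fun w => - f w) (- a).
Proof. by move=> fa; exact: is_deriveN. Qed.

Lemma is_derive_mul f g z v a b : is_derive z v f a -> is_derive z v g b ->
  is_derive z v (fun w => f w * g w) (a * g z + f z * b).
Proof.
move=> fa gb; apply: is_derive_eq (is_deriveM fa gb) _.
by rewrite /GRing.scale /=; ring.
Qed.

Lemma is_derive_bigsum (J : Type) (r : seq J) (F : J -> V -> R) (a : J -> R)
    z v :
  (forall j, is_derive z v (F j) (a j)) ->
  is_derive z v (fun w => \sum_(j <- r) F j w) (\sum_(j <- r) a j).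
Proof.
move=> Fa; elim: r => [|j r IH].
  rewrite big_nil (_ : (fun w => _) = cst 0); first exact: is_derive_cst.
  by apply/funext => w; rewrite big_nil.
rewrite big_cons (_ : (fun w => _) = fun w => F j w + \sum_(k <- r) F k w).
  exact: is_derive_add.
by apply/funext => w; rewrite big_cons.
Qed.

(** Both sides have the same difference quotient; this carries one-variable calculus over to
    directional derivatives. *)
Lemma is_derive_line f z v a :
  is_derive z v f a <-> is_derive (0 : R) 1 (fun h : R => f (h *: v + z)) a.
Proof.
have E : (fun h : R => h^-1 *: ((f \o shift z) (h *: v) - f z)) =
    fun h : R => h^-1 *: (((fun h : R => f (h *: v + z)) \o shift 0) (h *: 1)
      - f (0 *: v + z)).
  by apply/funext => h /=; rewrite addr0 scale0r add0r [h *: 1]mulr1.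
split=> -[d <-]; split.
- exact: (derivable1P f z v).1.
- by rewrite /derive -E.
- exact: (derivable1P f z v).2.
- by rewrite /derive E.
Qed.

(** Only the derivative of [f] along [v] is given, so [f] is restricted to the line through [z],
    where derivability is differentiability and the one-variable chain rule applies. *)
Lemma is_derive_comp (k : R -> R) f z v a b :
  is_derive z v f a -> is_derive (f z) 1 k b ->
  is_derive z v (fun w => k (f w)) (b * a).
Proof.
move=> /is_derive_line fa kb; apply/is_derive_line.
have kb' : is_derive (f (0 *: v + z)) 1 k b by rewrite scale0r add0r.
have df : differentiable (fun h : R => f (h *: v + z)) 0.
  by apply/derivable1_diffP; case: fa.
have dk : differentiable k (f (0 *: v + z)).
  by apply/derivable1_diffP; case: kb'.
split.
  apply/derivable1_diffP.
  exact: (@differentiable_comp _ _ _ _ (fun h : R => f (h *: v + z)) k).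
rewrite -derive1E (@derive1_comp _ (fun h : R => f (h *: v + z)) k).
- by rewrite !derive1E; case: fa => _ ->; case: kb' => _ ->.
- by case: fa.
- by case: kb'.
Qed.

End DirectionalDerivatives.

Section Lines.
Context {R : realType} {V : normedModType R}.
Implicit Types (f g : V -> R) (z u v : V).

Lemma is_derive_along f z v a (t : R) : is_derive (t *: v + z) v f a ->
  is_derive t 1 (fun h : R => f (h *: v + z)) a.
Proof.
move=> /is_derive_line fa.
suff -> : (fun h : R => f (h *: v + z)) =
    (fun s : R => (fun h : R => f (h *: v + (t *: v + z))) (s - t)).
  rewrite -[a]mulr1.
  apply: (@is_derive_comp _ _ (fun h : R => f (h *: v + (t *: v + z)))
    (fun s : R => s - t)).
    rewrite -[1 in X in is_derive _ _ _ X]subr0.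
    exact: is_deriveB.
  by rewrite subrr.
by apply/funext => s; rewrite addrA -scalerDl subrK.
Qed.

(** The line in direction [c *: v] is the line in direction [v] run at speed [c], including
    [c = 0]. *)
Lemma is_derive_dirZ f z v a (c : R) : is_derive z v f a ->
  is_derive z (c *: v) f (c * a).
Proof.
move=> fa; apply/is_derive_line.
rewrite (_ : (fun h : R => _) = fun h : R => (fun s : R => f (s *: v + z)) (h * c)).
  rewrite mulrC.
  apply: (@is_derive_comp _ _ (fun s : R => f (s *: v + z)) (fun h : R => h * c)).
    rewrite -[c in X in is_derive _ _ _ X]mul1r -[X in is_derive _ _ _ X]addr0.
    rewrite -[X in _ + X](mulr0 (0:R)).
    exact: (@is_derive_mul _ _ id (cst c)).
  by rewrite mul0r; exact: (is_derive_line f z v a).1.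
by apply/funext => h; rewrite scalerA.
Qed.

(* The mean value theorem turns the increment along [v] based at [z + h u]
   into a value of the continuous function ['D_v f] near [z]. *)
Lemma derive_dirD (U : set V) f z u v : open U -> U z ->
  (forall w, U w -> derivable f w u /\ derivable f w v) ->
  {for z, continuous ('D_v f)} ->
  is_derive z (u + v) f ('D_u f z + 'D_v f z).
Proof.
move=> oU Uz df cv.
suff H : (fun h : R => h^-1 *: ((f \o shift z) (h *: (u + v)) - f z)) @ 0^' -->
    'D_u f z + 'D_v f z.
  by split; [apply/cvg_ex; eexists; exact: H|exact: cvg_lim H].
have Hu : (fun h : R => h^-1 *: ((f \o shift z) (h *: u) - f z)) @ 0^' --> 'D_u f z.
  by case: (df _ Uz) => + _.
(* The increment is made along [u] from [z], then along [v] from [h *: u + z]; the first quotient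
   tends to ['D_u f z] by definition. *)
rewrite (_ : (fun h : R => _) =
    fun h : R => h^-1 *: ((f \o shift z) (h *: u) - f z) +
      h^-1 *: (f (h *: v + (h *: u + z)) - f (h *: u + z))); last first.
  apply/funext => h /=; rewrite -scalerDr; congr (_ *: _).
  have -> : h *: (u + v) + z = h *: v + (h *: u + z).
    by rewrite scalerDr addrA (addrC (h *: v)).
  by ring.
apply: cvgD; first exact: Hu.
apply/cvgrPdist_lt => e e0.
have : \forall w \near z, U w /\ `|'D_v f z - 'D_v f w| < e.
  apply: filterI; first exact: open_nbhs_nbhs.
  by move/cvgrPdist_lt : cv; apply.
move=> /nbhs_ballP [d /= d0 Hd].
(* Every point [(c * h) *: v + (h *: u + z)] with [0 <= c <= 1] lies within [|h| * N] of [z]; the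
   summand 1 makes [N] positive. *)
pose N := `|u| + `|v| + 1.
have N0 : 0 < N by rewrite ltr_wpDl ?addr_ge0.
near=> h.
have h0 : h != 0 by near: h; exact: nbhs_dnbhs_neq.
have hd : `|h| * N < d.
  rewrite -ltr_pdivlMr//; near: h; apply: dnbhs0_lt; exact: divr_gt0.
have inb (c : R) : 0 <= c <= 1 -> ball z d ((c * h) *: v + (h *: u + z)).
  move=> /andP[c0 c1]; rewrite -ball_normE /ball_ /=.
  rewrite addrA opprD addrCA subrr addr0 normrN.
  apply: le_lt_trans hd; apply: le_trans (ler_normD _ _) _.
  rewrite !normrZ (ger0_norm c0) -mulrA /N.
  have := ler_piMl (mulr_ge0 (normr_ge0 h) (normr_ge0 v)) c1.
  have := normr_ge0 h; lra.
(* The segment is parametrised by [s] in [0, 1], so that the mean value theorem applies whatever the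
   sign of [h]. *)
have dfs (s : R) : 0 <= s <= 1 ->
    is_derive s 1 (fun s : R => f ((s * h) *: v + (h *: u + z)))
      ('D_v f ((s * h) *: v + (h *: u + z)) * h).
  move=> sI.
  apply: (@is_derive_comp _ _ (fun r : R => f (r *: v + (h *: u + z)))
    (fun s : R => s * h)).
    rewrite -[h in X in is_derive _ _ _ X]mul1r -[X in is_derive _ _ _ X]addr0.
    rewrite -[X in _ + X](mulr0 (s:R)).
    exact: (@is_derive_mul _ _ id (cst h)).
  apply: is_derive_along; apply/derivableP.
  by apply: (df _ _).2; apply: (Hd _ _).1; apply: inb.
have [||c] := @MVT_segment _ (fun s : R => f ((s * h) *: v + (h *: u + z)))
    (fun s : R => 'D_v f ((s * h) *: v + (h *: u + z)) * h) 0 1 ler01.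
- by move=> s; rewrite in_itv /= => /andP[s0 s1]; apply: dfs; rewrite !ltW.
- apply: continuous_in_subspaceT => s; rewrite inE /= in_itv /= => /dfs[ds _].
  exact/differentiable_continuous/derivable1_diffP.
rewrite in_itv /= => cI; rewrite subr0 mulr1 mul1r mul0r scale0r add0r => ->.
rewrite [_ *: _]mulrC mulfK//.
by apply: (Hd _ _).2; apply: inb.
Unshelve. all: by end_near. Qed.

End Lines.

(** * Functions with continuous iterated directional derivatives *)

(** Finite-order form of [smooth_on], suited to induction on the order. Continuity is demanded at
    each order because directional derivatives alone do not provide it. *)
Fixpoint Ck {R : realType} {V : normedModType R} (n : nat) (U : set V)
    (f : V -> R) : Prop :=
  (forall z, U z -> {for z, continuous f}) /\
  (if n is m.+1 then forall v, (forall z, U z -> derivable f z v) /\ Ck m U ('D_v f)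
   else True).

Section Ck_theory.
Context {R : realType} {V : normedModType R} (U : set V) (oU : open U).
Implicit Types (f g : V -> R) (z u v : V).

Lemma near_in z : U z -> \forall w \near z, U w.
Proof. by move=> Uz; exact: open_nbhs_nbhs. Qed.

Lemma eq_on_near f g z : U z -> {in U, f =1 g} -> \near z, f z = g z.
Proof.
by move=> Uz fg; apply: filterS (near_in Uz) => w Uw; rewrite fg// inE.
Qed.

Lemma eq_on_derive f g z v : U z -> {in U, f =1 g} -> 'D_v f z = 'D_v g z.
Proof. by move=> Uz fg; apply: near_eq_derive; exact: eq_on_near. Qed.

Lemma eq_on_is_derive f g z v a : U z -> {in U, f =1 g} ->
  is_derive z v f a -> is_derive z v g a.
Proof. by move=> Uz fg; apply: near_eq_is_derive; exact: eq_on_near. Qed.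

Lemma Ck_continuous n f z : Ck n U f -> U z -> {for z, continuous f}.
Proof. by case: n => [|n] /= [+ _] Uz; exact. Qed.

Lemma Ck_is_derive n f z v : Ck n.+1 U f -> U z -> is_derive z v f ('D_v f z).
Proof. by move=> /= [_ /(_ v)[df _]] Uz; exact/derivableP/df. Qed.

Lemma Ck_derive n f v : Ck n.+1 U f -> Ck n U ('D_v f).
Proof. by move=> /= [_ /(_ v)[_ ]]. Qed.

Lemma CkW n f : Ck n.+1 U f -> Ck n U f.
Proof.
elim: n f => [|n IH] f /= [cf df]; first by [].
by split=> // v; have [dv C] := df v; split=> //; exact: IH.
Qed.

Lemma eq_on_Ck n f g : {in U, f =1 g} -> Ck n U f -> Ck n U g.
Proof.
elim: n f g => [|n IH] f g fg /= [cf df].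
all: have cg z : U z -> {for z, continuous g}.
  1,3: move=> Uz; rewrite /prop_for /continuous_at -(fg z) ?inE//.
  1,2: apply: cvg_trans (cf z Uz); apply: near_eq_cvg; exact: eq_on_near.
- by [].
- split=> // v; have [dv C] := df v; split.
    by move=> z Uz; apply: near_eq_derivable (dv _ Uz); exact: eq_on_near.
  by apply: IH C => z /set_mem Uz; exact: eq_on_derive.
Qed.

(** Introduction rule behind all the closure lemmas: a formula for the derivatives is only needed on
    [U], where [eq_on_Ck] substitutes it for ['D_v f]. *)
Lemma Ck_succ n f (df : V -> V -> R) :
  (forall z, U z -> {for z, continuous f}) ->
  (forall z v, U z -> is_derive z v f (df v z)) -> (forall v, Ck n U (df v)) ->
  Ck n.+1 U f.
Proof.
move=> cf dfP C; split=> // v; split=> [z Uz|]; first by have [] := dfP z v Uz.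
apply: eq_on_Ck (C v) => z /set_mem Uz.
by have [_ ->] := dfP z v Uz.
Qed.

Lemma Ck_cst n (a : R) : Ck n U (fun=> a).
Proof.
elim: n a => [|n IH] a; first by split=> // z _; exact: cvg_cst.
apply: (@Ck_succ n (fun=> a) (fun _ _ => 0)) => [z _|_]; [exact: cvg_cst|exact: IH].
Qed.

Lemma CkD n f g : Ck n U f -> Ck n U g -> Ck n U (fun z => f z + g z).
Proof.
have cD m f' g' z : Ck m U f' -> Ck m U g' -> U z ->
    {for z, continuous (fun z => f' z + g' z)}.
  move=> Cf Cg Uz; apply: continuousD; first exact: Ck_continuous Cf Uz.
  exact: Ck_continuous Cg Uz.
elim: n f g => [|n IH] f g Cf Cg.
  by split=> // z; exact: cD _ _ _ _ Cf Cg.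
apply: (@Ck_succ n (fun z => f z + g z)
  (fun v z => 'D_v f z + 'D_v g z)) => [z|z v Uz|v].
- exact: cD _ _ _ _ Cf Cg.
- by apply: is_derive_add; [exact: Ck_is_derive Cf Uz|exact: Ck_is_derive Cg Uz].
- by apply: IH; exact: Ck_derive.
Qed.

Lemma CkM n f g : Ck n U f -> Ck n U g -> Ck n U (fun z => f z * g z).
Proof.
have cM m f' g' z : Ck m U f' -> Ck m U g' -> U z ->
    {for z, continuous (fun z => f' z * g' z)}.
  move=> Cf Cg Uz; apply: continuousM; first exact: Ck_continuous Cf Uz.
  exact: Ck_continuous Cg Uz.
elim: n f g => [|n IH] f g Cf Cg.
  by split=> // z; exact: cM _ _ _ _ Cf Cg.
apply: (@Ck_succ n (fun z => f z * g z)
  (fun v z => 'D_v f z * g z + f z * 'D_v g z)) => [z|z v Uz|v].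
- exact: cM _ _ _ _ Cf Cg.
- by apply: is_derive_mul; [exact: Ck_is_derive Cf Uz|exact: Ck_is_derive Cg Uz].
- by apply: CkD; apply: IH; first [exact: Ck_derive|exact: CkW].
Qed.

Lemma CkN n f : Ck n U f -> Ck n U (fun z => - f z).
Proof.
move=> Cf; apply: (eq_on_Ck _ (CkM (Ck_cst n (-1)) Cf)) => z _.
by rewrite mulN1r.
Qed.

Lemma Ck_sum n (J : Type) (r : seq J) (F : J -> V -> R) :
  (forall j, Ck n U (F j)) -> Ck n U (fun z => \sum_(j <- r) F j z).
Proof.
move=> CF; elim: r => [|j r IH].
  by apply: (eq_on_Ck _ (Ck_cst n 0)) => z _; rewrite big_nil.
by apply: (eq_on_Ck _ (CkD (CF j) IH)) => z _; rewrite big_cons.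
Qed.

Lemma CkX n f m : Ck n U f -> Ck n U (fun z => f z ^+ m).
Proof.
move=> Cf; elim: m => [|m IH].
  by apply: (eq_on_Ck _ (Ck_cst n 1)) => z _; rewrite expr0.
by apply: (eq_on_Ck _ (CkM Cf IH)) => z _; rewrite exprS.
Qed.

(** The derivative of the inverse is a polynomial in the inverse itself and ['D_v f], so the
    induction on the order closes. *)
Lemma CkV n f : (forall z, U z -> f z != 0) -> Ck n U f -> Ck n U (fun z => (f z)^-1).
Proof.
move=> f0; have cV m z : Ck m U f -> U z -> {for z, continuous (fun z => (f z)^-1)}.
  by move=> Cf Uz; apply: continuousV; [exact: f0|exact: Ck_continuous Cf Uz].
elim: n => [|n IH] Cf; first by split=> // z; exact: cV _ _ Cf.
apply: (@Ck_succ n (fun z => (f z)^-1)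
  (fun v z => - ((f z)^-1 * (f z)^-1 * 'D_v f z))) => [z|z v Uz|v].
- exact: cV _ _ Cf.
- have := Ck_is_derive v Cf Uz => -[df _]; split; first exact: derivableV (f0 _ Uz) df.
  by rewrite (deriveV (f0 _ Uz) df) scaleNr /GRing.scale /= expr2 invfM.
- by apply: CkN; apply: CkM (Ck_derive v Cf); apply: CkM; apply: IH; exact: CkW.
Qed.

Lemma Ck_expR n f : Ck n U f -> Ck n U (fun z => expR (f z)).
Proof.
have cE m z : Ck m U f -> U z -> {for z, continuous (fun z => expR (f z))}.
  move=> Cf Uz; apply: (@continuous_comp _ _ _ f expR); last exact: continuous_expR.
  exact: Ck_continuous Cf Uz.
elim: n => [|n IH] Cf; first by split=> // z; exact: cE _ _ Cf.
apply: (@Ck_succ n (fun z => expR (f z))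
  (fun v z => expR (f z) * 'D_v f z)) => [z|z v Uz|v].
- exact: cE _ _ Cf.
- exact: (@is_derive_comp _ _ expR f _ _ _ _ (Ck_is_derive v Cf Uz)).
- by apply: CkM (Ck_derive v Cf); apply: IH; exact: CkW.
Qed.

Lemma Ck_sqrt n f : (forall z, U z -> 0 < f z) -> Ck n U f ->
  Ck n U (fun z => Num.sqrt (f z)).
Proof.
move=> f0; have cE m z : Ck m U f -> U z ->
    {for z, continuous (fun z => Num.sqrt (f z))}.
  move=> Cf Uz; apply: (@continuous_comp _ _ _ f Num.sqrt); last exact: sqrt_continuous.
  exact: Ck_continuous Cf Uz.
elim: n => [|n IH] Cf; first by split=> // z; exact: cE _ _ Cf.
apply: (@Ck_succ n (fun z => Num.sqrt (f z))
  (fun v z => (2 * Num.sqrt (f z))^-1 * 'D_v f z)) => [z|z v Uz|v].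
- exact: cE _ _ Cf.
- apply: (@is_derive_comp _ _ Num.sqrt f _ _ _ _ (Ck_is_derive v Cf Uz)).
  by apply: is_derive1_sqrt; exact: f0.
- apply: CkM (Ck_derive v Cf); apply: CkV => [z Uz|].
    by rewrite mulf_neq0// gt_eqF// sqrtr_gt0 f0.
  by apply: CkM (Ck_cst _ _) _; apply: IH; exact: CkW.
Qed.

(** This makes the signature [eps] locally constant, hence of zero derivative. *)
Lemma near_sg f z : {for z, continuous f} -> f z != 0 ->
  \forall w \near z, Num.sg (f w) = Num.sg (f z).
Proof.
move=> cf; rewrite neq_lt => /orP[fz|fz].
- have /cvgr_lt/(_ _ fz) : f w @[w --> z] --> f z by [].
  apply: filterS => w fw.
  by rewrite !ltr0_sg.
- have /cvgr_gt/(_ _ fz) : f w @[w --> z] --> f z by [].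
  apply: filterS => w fw.
  by rewrite !gtr0_sg.
Qed.

Lemma is_derive_sg f z v : {for z, continuous f} -> f z != 0 ->
  is_derive z v (fun w => Num.sg (f w)) 0.
Proof.
move=> cf fz; apply: (@near_eq_is_derive _ _ _ (cst (Num.sg (f z)))).
  by have := near_sg cf fz; apply: filterS => w ->.
Qed.

Lemma Ck_sg n f : (forall z, U z -> f z != 0) -> Ck 0 U f ->
  Ck n U (fun z => Num.sg (f z)).
Proof.
move=> f0 [cf _].
have cS z : U z -> {for z, continuous (fun z => Num.sg (f z))}.
  move=> Uz; have H : (fun=> Num.sg (f z)) @ z --> Num.sg (f z) by exact: cvg_cst.
  apply: cvg_trans H.
  apply: near_eq_cvg; have := near_sg (cf _ Uz) (f0 _ Uz).
  by apply: filterS => w ->.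
case: n => [|n]; first by split; [exact: cS|].
apply: (@Ck_succ n (fun z => Num.sg (f z)) (fun v z => 0)) => // [z v Uz|v];
  last exact: Ck_cst.
by apply: is_derive_sg; [exact: cf|exact: f0].
Qed.

Lemma smooth_on_Ck n f : smooth_on U f -> Ck n U f.
Proof.
(* The claim is generalised over the directions already used, since each derivative lengthens the
   list. *)
move=> sf; suff H (s : seq V) : Ck n U (foldr (fun v h => 'D_v h) f s).
  exact: (H [::]).
elim: n s => [|n IH] s /=.
  by split=> // z Uz; have [] := sf s z Uz.
split=> [z Uz|v]; first by have [] := sf s z Uz.
split; last exact: (IH (v :: s)).
by move=> z Uz; have [_] := sf s z Uz.
Qed.

(** Additivity in the direction rests on the continuity of ['D_v f]; it serves to expand a vertical
    direction in the coordinate ones. *)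
Lemma Ck_dirD n f z u v : Ck n.+1 U f -> U z ->
  'D_(u + v) f z = 'D_u f z + 'D_v f z.
Proof.
move=> Cf Uz; have H w : U w -> derivable f w u /\ derivable f w v.
  by case: Cf => _ df Uw; split; exact: (df _).1.
by case: (derive_dirD oU Uz H (Ck_continuous (Ck_derive v Cf) Uz)).
Qed.

Lemma Ck_dirZ n f z v (c : R) : Ck n.+1 U f -> U z ->
  'D_(c *: v) f z = c * 'D_v f z.
Proof. by move=> Cf Uz; case: (is_derive_dirZ c (Ck_is_derive v Cf Uz)). Qed.

End Ck_theory.

(** * Homogeneous functions on a cone *)

Lemma sum_ord2 (R : pzSemiRingType) (f : 'I_2 -> R) : \sum_i f i = f 0 + f 1.
Proof. by rewrite !big_ord_recl big_ord0 addr0; congr (_ + f _); exact: val_inj. Qed.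

Lemma ord2P (P : 'I_2 -> Prop) : P 0 -> P 1 -> forall i, P i.
Proof.
move=> P0 P1 [[|[|//]] lti].
- by rewrite (_ : Ordinal lti = 0) //; exact: val_inj.
- by rewrite (_ : Ordinal lti = 1) //; exact: val_inj.
Qed.

Section Homogeneity.
Context {R : realType}.
Local Notation V := (TV R).
Variable U : set V.
Hypothesis oU : open U.
Hypothesis coneU : forall z (t : R), 0 < t -> U z -> U (z.1, t *: z.2).
Implicit Types (f g : V -> R) (z u v : V) (i j k : 'I_2).

Definition homog (r : nat) f :=
  forall z (t : R), 0 < t -> U z -> f (z.1, t *: z.2) = t ^+ r * f z.

Lemma homogD r f g : homog r f -> homog r g -> homog r (fun z => f z + g z).
Proof. by move=> hf hg z t t0 Uz; rewrite hf// hg// mulrDr. Qed.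

Lemma homogN r f : homog r f -> homog r (fun z => - f z).
Proof. by move=> hf z t t0 Uz; rewrite hf// mulrN. Qed.

Lemma homogM r s f g : homog r f -> homog s g -> homog (r + s) (fun z => f z * g z).
Proof. by move=> hf hg z t t0 Uz; rewrite hf// hg// exprD; ring. Qed.

Lemma homogZ r (c : R) f : homog r f -> homog r (fun z => c * f z).
Proof. by move=> hf z t t0 Uz; rewrite hf// mulrCA. Qed.

Lemma homog_sum r (F : 'I_2 -> V -> R) : (forall j, homog r (F j)) ->
  homog r (fun z => \sum_j F j z).
Proof. by move=> hF z t t0 Uz; rewrite mulr_sumr; apply: eq_bigr => j _; exact: hF. Qed.

Lemma homog_fibre_coord k : homog 1 (fun z => z.2 0 k).
Proof. by move=> z t t0 Uz; rewrite /= mxE expr1. Qed.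

Lemma is_derive_fibre_coord z v k : is_derive z v (fun w : V => w.2 0 k) (v.2 0 k).
Proof.
apply/is_derive_line.
rewrite (_ : (fun h : R => _) = fun h : R => h * v.2 0 k + z.2 0 k); last first.
  by apply/funext => h; rewrite /= !mxE.
rewrite -[v.2 0 k in X in is_derive _ _ _ X]mul1r -[X in is_derive _ _ _ X]addr0.
apply: is_derive_add; rewrite -[X in is_derive _ _ _ X]addr0 -[X in _ + X](mulr0 (0:R)).
exact: (@is_derive_mul _ _ id (cst _)).
Qed.

Lemma Ck_fibre_coord n k : Ck n U (fun z => z.2 0 k).
Proof.
have cc z : {for z, continuous (fun w : V => w.2 0 k)}.
  apply: (@continuous_comp _ _ _ (fun w : V => w.2) (fun M : 'rV[R]_2 => M 0 k)).
    exact: cvg_snd.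
  exact: coord_continuous.
case: n => [|n]; first by split.
apply: (@Ck_succ _ _ _ oU n (fun z : V => z.2 0 k) (fun v _ => v.2 0 k)) => //.
  by move=> z v _; exact: is_derive_fibre_coord.
by move=> v; exact: Ck_cst.
Qed.

Lemma near_line z v : U z -> \forall h \near (0 : R), U (h *: v + z).
Proof.
move=> Uz; have : (fun h : R => h *: v + z) @ (0 : R) --> z.
  rewrite -[X in _ --> X]add0r -[X in _ --> X + _](scale0r v).
  by apply: cvgD; [apply: cvgZr_tmp; exact: cvg_id|exact: cvg_cst].
by apply; exact: (near_in oU Uz).
Qed.

(** Fibre scaling carries the line through [z] along [v] to the line through the scaled point along
    the scaled vector, and there [f] is multiplied by [t ^+ r]. *)
Lemma homog_dir r f z v (t c : R) : homog r f -> 0 < t -> U z -> is_derive z v f c ->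
  is_derive ((z.1, t *: z.2) : V) ((v.1, t *: v.2) : V) f (t ^+ r * c).
Proof.
move=> hf t0 Uz /is_derive_line fc; apply/is_derive_line.
apply: (@near_eq_is_derive _ _ _ (fun h : R => t ^+ r * f (h *: v + z))).
  have := near_line v Uz; apply: filterS => h Uh.
  rewrite -hf//; congr (f (_, _)) => //=.
  by rewrite scalerDr !scalerA mulrC.
Qed.

Lemma homog_dx r f i : homog r f -> Ck 1 U f -> homog r (dx i f).
Proof.
move=> hf Cf z t t0 Uz; rewrite /dx.
have [_ <-] := homog_dir hf t0 Uz (Ck_is_derive ((delta_mx 0 i, 0) : V) Cf Uz).
by rewrite /= scaler0.
Qed.

(** Fibre scaling multiplies a vertical direction by [t], which takes off one degree; the horizontal
    coordinate directions of [homog_dx] are fixed. *)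
Lemma homog_dy r f i : homog r.+1 f -> Ck 1 U f -> homog r (dy i f).
Proof.
move=> hf Cf z t t0 Uz; rewrite /dy.
have [_] := homog_dir hf t0 Uz (Ck_is_derive ((0, delta_mx 0 i) : V) Cf Uz).
have -> : (((0, delta_mx 0 i) : V).1, t *: ((0, delta_mx 0 i) : V).2) =
    t *: ((0, delta_mx 0 i) : V) by congr (_, _); rewrite /= scaler0.
rewrite (Ck_dirZ _ _ Cf (coneU t0 Uz)) exprS -mulrA => /mulfI.
by apply; rewrite gt_eqF.
Qed.

Lemma derive_vertical f z : Ck 1 U f -> U z ->
  'D_((0, z.2) : V) f z = \sum_i z.2 0 i * dy i f z.
Proof.
move=> Cf Uz; rewrite sum_ord2 /dy -!(Ck_dirZ _ _ Cf Uz) -(Ck_dirD oU _ _ Cf Uz).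
congr ('D_ _ f z); congr (_, _); first by rewrite /= !scaler0 addr0.
apply/rowP => j; rewrite !mxE /=.
by elim/ord2P: j; rewrite !eqxx /= ?mulr1 ?mulr0 ?addr0 ?add0r.
Qed.

(** Along the ray through [z], [f] takes the value [(h + 1) ^+ r * f z], whose derivative at [h = 0]
    is [r%:R * f z]. *)
Lemma euler r f z : homog r f -> Ck 1 U f -> U z ->
  \sum_i z.2 0 i * dy i f z = r%:R * f z.
Proof.
move=> hf Cf Uz; rewrite -derive_vertical//.
suff: is_derive z ((0, z.2) : V) f (r%:R * f z) by case.
apply/is_derive_line.
apply: (@near_eq_is_derive _ _ _ (fun h : R => (h + 1) ^+ r * f z)).
  (* Homogeneity concerns positive factors, here [h + 1]. *)
  have : \forall h \near (0 : R), -1 < h by apply: lt_nbhsr; rewrite ltrN10.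
  apply: filterS => h h1; rewrite -hf//; last lra.
  by congr (f (_, _)); rewrite /= ?scaler0 ?add0r// scalerDl scale1r.
rewrite -[X in is_derive _ _ _ X]addr0 -[X in _ + X](mulr0 ((0 + 1) ^+ r)).
apply: (@is_derive_mul _ _ (fun h : R => (h + 1) ^+ r) (cst (f z))).
rewrite -[r%:R]mulr1.
apply: (@is_derive_comp _ _ (fun s : R => s ^+ r) (fun h : R => h + 1)).
  by rewrite -[X in is_derive _ _ _ X]addr0; exact: is_derive_add.
rewrite add0r; split; first exact: exprn_derivable.
by rewrite exp_derive expr1n /GRing.scale /= !mulr1.
Qed.

End Homogeneity.

(** * The Euler-Lagrange equations *)

Section EulerLagrange.
Context {R : realType}.
Local Notation V := (TV R).
Variable U : set V.
Hypothesis oU : open U.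
Hypothesis coneU : forall z (t : R), 0 < t -> U z -> U (z.1, t *: z.2).
Implicit Types (L : V -> R) (G : 'I_2 -> V -> R) (z : V) (i j k : 'I_2).

(** The Euler-Lagrange equations of the Lagrangian [L] along the spray with coefficients [G], the
    mixed derivatives being in the order that [dy_spray_action] produces. *)
Definition spray_equation L G z := forall i,
  \sum_j 2 * dy i (dy j L) z * G j z =
  \sum_k z.2 0 k * dy i (dx k L) z - dx i L z.

Lemma spray_coefP (K : V -> R) G z : metric K z \in unitmx ->
  (forall j, spray_coef K j z = G j z) <->
  spray_equation (fun w => K w ^+ 2) G z.
Proof.
move=> Ku; pose T i := \sum_k z.2 0 k * dy i (dx k (fun w => K w ^+ 2)) z
  - dx i (fun w => K w ^+ 2) z.
(* The 4 cancels the [4^-1] of [spray_coef]; times the [2^-1] of [metric] it gives the coefficient 2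
   of [spray_equation]. *)
pose g : 'cV[R]_2 := \col_j (4 * G j z).
have E1 : (forall j, spray_coef K j z = G j z) <->
    invmx (metric K z) *m (\col_i T i) = g.
  split=> [H|/colP H j].
    apply/colP => j; rewrite !mxE -H /spray_coef mulrA divff ?mul1r//.
    by apply: eq_bigr => i _; rewrite !mxE.
  have := H j; rewrite !mxE /spray_coef => E.
  transitivity (4^-1 * (4 * G j z)); last by rewrite mulKf.
  by rewrite -E; congr (_ * _); apply: eq_bigr => i _; rewrite !mxE.
have E2 : spray_equation (fun w => K w ^+ 2) G z <-> metric K z *m g = \col_i T i.
  have E i : (metric K z *m g) i 0 =
      \sum_j 2 * dy i (dy j (fun w => K w ^+ 2)) z * G j z.
    by rewrite mxE; apply: eq_bigr => j _; rewrite !mxE; field.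
  split=> [H|/colP H i]; first by apply/colP => i; rewrite E H mxE.
  by rewrite -E H mxE.
split=> [/E1 H|/E2 H]; [apply: E2.2|apply: E1.2].
- by rewrite -H mulKVmx.
- by rewrite -H mulKmx.
Qed.

Definition spray_action L G z : R :=
  \sum_k z.2 0 k * dx k L z - \sum_j 2 * G j z * dy j L z.

Lemma spray_action_leibniz (y a b c d g h : 'I_2 -> R) i :
  \sum_k ((k == i)%:R * a k + y k * b k)
    - \sum_j ((2 * c j) * d j + (2 * g j) * h j) =
  a i + \sum_k y k * b k - 2 * \sum_j c j * d j - \sum_j 2 * h j * g j.
Proof.
rewrite !sum_ord2; move: i; apply: ord2P.
all: by rewrite ?eqxx ?(negbTE (oner_neq0 _)) /=; ring.
Qed.

(** With [c i j] the connection coefficients, the hypothesis is Euler's identity for the degree 2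
    functions [g j], and the conclusion reads S L = y^i delta_i L. *)
Lemma spray_action_euler (y a d g : 'I_2 -> R) (c : 'I_2 -> 'I_2 -> R) :
  (forall j, \sum_i y i * c i j = 2 * g j) ->
  \sum_k y k * a k - \sum_j 2 * g j * d j =
  \sum_i y i * (a i - \sum_j c i j * d j).
Proof. by move=> cg; rewrite !sum_ord2 -!cg !sum_ord2; ring. Qed.

(** Under the spray equation the second and last terms add up to [dx i L z], and the right-hand side
    becomes 2 delta_i L. *)
Lemma dy_spray_action L G z i : Ck 2 U L -> (forall j, Ck 1 U (G j)) -> U z ->
  dy i (spray_action L G) z =
  dx i L z + \sum_k z.2 0 k * dy i (dx k L) z
  - 2 * \sum_j dy i (G j) z * dy j L z - \sum_j 2 * dy i (dy j L) z * G j z.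
Proof.
move=> CL CG Uz.
have D f : Ck 1 U f -> is_derive z ((0, delta_mx 0 i) : V) f (dy i f z).
  by move=> Cf; exact: (Ck_is_derive _ Cf Uz).
have H : is_derive z ((0, delta_mx 0 i) : V) (spray_action L G)
    (\sum_k ((k == i)%:R * dx k L z + z.2 0 k * dy i (dx k L) z)
     - \sum_j ((2 * dy i (G j) z) * dy j L z + (2 * G j z) * dy i (dy j L) z)).
  apply: is_derive_add; last apply: is_derive_opp; apply: is_derive_bigsum => j.
    apply: is_derive_mul; last by apply: D; exact: Ck_derive.
    have := is_derive_fibre_coord z ((0, delta_mx 0 i) : V) j.
    by rewrite /= mxE eqxx.
  apply: is_derive_mul; last by apply: D; exact: Ck_derive.
  rewrite -[X in is_derive _ _ _ X]add0r -[X in X + _](mul0r (G j z)).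
  by apply: is_derive_mul; exact: D.
rewrite [LHS](@derive_val _ _ _ _ _ _ _ H).
exact: (spray_action_leibniz (fun k => z.2 0 k) (fun k => dx k L z)
  (fun k => dy i (dx k L) z) (fun j => dy i (G j) z) (fun j => dy j L z)
  (fun j => G j z) (fun j => dy i (dy j L) z) i).
Qed.

(* Euler's identity in the fibres forces [S L = 0]: contracting
   [d(S L)/dy^i = 2 delta_i L] with [y^i] gives [3 S L = 2 S L]. *)
Lemma spray_equation_horizontal L G :
  Ck 2 U L -> (forall j, Ck 1 U (G j)) ->
  homog U 2 L -> (forall j, homog U 2 (G j)) ->
  (forall z, U z -> spray_equation L G z) <->
  (forall z, U z -> forall i, dx i L z = \sum_j dy i (G j) z * dy j L z).
Proof.
move=> CL CG hL hG.
have CL1 : Ck 1 U L by exact: CkW.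
have Gy z j : U z -> \sum_i z.2 0 i * dy i (G j) z = 2 * G j z.
  by move=> Uz; exact: (euler oU (hG j) (CG j) Uz).
have SLE z : U z -> spray_action L G z =
    \sum_i z.2 0 i * (dx i L z - \sum_j dy i (G j) z * dy j L z).
  move=> Uz; exact: (spray_action_euler (fun k => dx k L z) (fun j => dy j L z)
    (c := fun i j => dy i (G j) z) (fun j => Gy z j Uz)).
split=> H z Uz i.
- have dS w k : U w -> dy k (spray_action L G) w =
      2 * (dx k L w - \sum_j dy k (G j) w * dy j L w).
    by move=> Uw; rewrite dy_spray_action// (H w Uw k); ring.
  have hS : homog U 3 (spray_action L G).
    apply: homogD; first by apply: homog_sum => k; apply: (@homogM _ _ 1 2);
      [exact: homog_fibre_coord|exact: homog_dx].
    apply: homogN; apply: homog_sum => j; apply: (@homogM _ _ 2 1);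
      [exact: homogZ|exact: homog_dy].
  have CS : Ck 1 U (spray_action L G).
    apply: (CkD oU).
      apply: (Ck_sum oU) => k.
      by apply: (CkM oU); [exact: Ck_fibre_coord|exact: Ck_derive].
    apply: (CkN oU); apply: (Ck_sum oU) => j; apply: (CkM oU).
      by apply: (CkM oU); [exact: Ck_cst|exact: CG].
    exact: Ck_derive.
  have S0 w : U w -> spray_action L G w = 0.
    move=> Uw; have := euler oU hS CS Uw.
    have -> : \sum_k w.2 0 k * dy k (spray_action L G) w = 2 * spray_action L G w.
      by rewrite SLE// mulr_sumr; apply: eq_bigr => k _; rewrite dS// mulrCA.
    lra.
  have := dS z i Uz; rewrite {1}/dy (@eq_on_derive _ _ U oU _ (cst 0)) ?derive_cst//.
    lra.
  by move=> w /set_mem Uw; exact: S0.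
(* Conversely delta_i L = 0 contracted with y^i gives S L = 0 on an open set, so the left-hand side
   of [dy_spray_action] vanishes and what remains is the spray equation. *)
- have S0 w : U w -> spray_action L G w = 0.
    move=> Uw; rewrite SLE//; apply: big1 => k _.
    by rewrite -H// subrr mulr0.
  have := dy_spray_action i CL CG Uz.
  rewrite {1}/dy (@eq_on_derive _ _ U oU _ (cst 0)) ?derive_cst//.
    by rewrite -(H z Uz i); lra.
  by move=> w /set_mem Uw; exact: S0.
Qed.

End EulerLagrange.

(** * The metric and its spray *)

(** The cofactor formula; in ['I_2], [1 - i] is the index other than [i]. *)
Lemma invmx2 (K : fieldType) (A : 'M[K]_2) (i j : 'I_2) : A \in unitmx ->
  invmx A i j = (\det A)^-1 *
    (if i == j then A (1 - i) (1 - i) else - A i j).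
Proof.
move=> uA; rewrite /invmx uA mxE mxE; congr (_ * _).
rewrite /cofactor det_mx11 !mxE.
have L0 (k : 'I_1) : lift (0 : 'I_2) k = 1 by rewrite ord1; exact: val_inj.
have L1 (k : 'I_1) : lift (1 : 'I_2) k = 0 by rewrite ord1; exact: val_inj.
have S1 : 1 - 1 = 0 :> 'I_2 by exact: val_inj.
have S0 : 1 - 0 = 1 :> 'I_2 by exact: val_inj.
move: i j; apply: ord2P; apply: ord2P; rewrite ?L0 ?L1 ?S0 ?S1 /=.
- by rewrite expr0 mul1r.
- by rewrite expr1 mulN1r.
- by rewrite expr1 mulN1r.
- by rewrite expr2 mulrNN !mul1r.
Qed.

Lemma det2 (K : comNzRingType) (A : 'M[K]_2) :
  \det A = A 0 0 * A 1 1 - A 0 1 * A 1 0.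
Proof.
rewrite (expand_det_row _ 0) !big_ord_recl big_ord0 addr0.
rewrite /cofactor !det_mx11 !mxE /=.
have L0 (k : 'I_1) : lift (0 : 'I_2) k = 1 by rewrite ord1; exact: val_inj.
have L1 (k : 'I_1) : lift (1 : 'I_2) k = 0 by rewrite ord1; exact: val_inj.
by rewrite !L0 L1 expr0 mul1r expr1 mulN1r mulrN.
Qed.

Section Regularity.
Context {R : realType}.
Local Notation V := (TV R).
Variable U : set V.
Hypothesis oU : open U.
Hypothesis coneU : forall z (t : R), 0 < t -> U z -> U (z.1, t *: z.2).
Variable K : V -> R.
Hypothesis CK : forall n, Ck n U K.
Hypothesis hK : homog U 1 K.
Hypothesis uK : forall z, U z -> metric K z \in unitmx.
Implicit Types (z : V) (i j k : 'I_2).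

Local Notation L := (fun w : V => K w ^+ 2).

Lemma Ck_sq n : Ck n U L.
Proof. exact: CkX. Qed.

Lemma homog_sq : homog U 2 L.
Proof. by move=> z t t0 Uz; rewrite hK// exprMn expr1. Qed.

Lemma metricE z i j : metric K z i j = 2^-1 * dy i (dy j L) z.
Proof. by rewrite mxE. Qed.

Lemma Ck_metric n i j : Ck n U (fun z => metric K z i j).
Proof.
apply: (eq_on_Ck oU (f := fun z => 2^-1 * dy i (dy j L) z)).
  by move=> z _; rewrite metricE.
by apply: CkM => //; [exact: Ck_cst|do 2 apply: Ck_derive; exact: Ck_sq].
Qed.

Lemma homog_metric i j : homog U 0 (fun z => metric K z i j).
Proof.
have H : homog U 0 (dy i (dy j L)).
  apply: (homog_dy oU coneU); last by apply: Ck_derive; exact: Ck_sq.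
  by apply: (homog_dy oU coneU); [exact: homog_sq|exact: Ck_sq].
move=> z t t0 Uz; apply: etrans (metricE _ i j) _.
apply: etrans (congr1 _ (H z t t0 Uz)) _.
by rewrite metricE mulrCA.
Qed.

Lemma Ck_det_metric n : Ck n U (fun z => \det (metric K z)).
Proof.
apply: (eq_on_Ck oU (f := fun z => metric K z 0 0 * metric K z 1 1
   + - (metric K z 0 1 * metric K z 1 0))).
  by move=> z _; rewrite det2.
by apply: CkD => //; [|apply: CkN => //]; apply: CkM => //; exact: Ck_metric.
Qed.

Lemma det_metric_neq0 z : U z -> \det (metric K z) != 0.
Proof. by move=> Uz; rewrite -unitfE -unitmxE uK. Qed.

Lemma Ck_metric_inv n i j : Ck n U (fun z => metric_inv K z i j).
Proof.
apply: (eq_on_Ck oU (f := fun z => (\det (metric K z))^-1 *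
    (if i == j then metric K z (1 - i) (1 - i) else - metric K z i j))).
  by move=> z /set_mem Uz; rewrite [RHS]invmx2 ?uK.
apply: CkM => //.
  by apply: CkV => //; [exact: det_metric_neq0|exact: Ck_det_metric].
by case: (i == j); [|apply: CkN => //]; exact: Ck_metric.
Qed.

Lemma homog_metric_inv i j : homog U 0 (fun z => metric_inv K z i j).
Proof.
move=> z t t0 Uz.
have E : metric K (z.1, t *: z.2) = metric K z.
  apply/matrixP => a b; exact: etrans (homog_metric a b t0 Uz) (mul1r _).
exact: etrans (congr1 (fun A : 'M[R]_2 => invmx A i j) E) (esym (mul1r _)).
Qed.

Lemma Ck_spray_coef n i : Ck n U (spray_coef K i).
Proof.
apply: CkM => //; first exact: Ck_cst.
apply: Ck_sum => // j; apply: CkM => //; first exact: Ck_metric_inv.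
apply: CkD => //; last by apply: CkN => //; apply: Ck_derive; exact: Ck_sq.
apply: Ck_sum => // k; apply: CkM => //; first exact: Ck_fibre_coord.
by do 2 apply: Ck_derive; exact: Ck_sq.
Qed.

Lemma homog_spray_coef i : homog U 2 (spray_coef K i).
Proof.
apply: homogZ; apply: homog_sum => j; apply: (@homogM _ _ 0 2).
  exact: homog_metric_inv.
have hx k : homog U 2 (dx k L).
  by apply: (homog_dx oU); [exact: homog_sq|exact: Ck_sq].
apply: homogD; last exact: homogN.
apply: homog_sum => k; apply: (@homogM _ _ 1 1); first exact: homog_fibre_coord.
by apply: (homog_dy oU coneU) => //; apply: Ck_derive; exact: Ck_sq.
Qed.

(** By [spray_coefP] the square of [K] solves the Euler-Lagrange equations along its own spray. *)
Lemma spray_horizontal z i : U z ->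
  dx i L z = \sum_j connection K i j z * dy j L z.
Proof.
move=> Uz.
apply: (spray_equation_horizontal oU coneU _ _ _ _).1 => // [|j||j|w Uw].
- exact: Ck_sq.
- exact: Ck_spray_coef.
- exact: homog_sq.
- exact: homog_spray_coef.
- by apply: (spray_coefP _ (uK Uw)).1.
Qed.

Lemma metric_fibre_l z j : U z ->
  \sum_i z.2 0 i * metric K z i j = 2^-1 * dy j L z.
Proof.
move=> Uz; transitivity (2^-1 * \sum_i z.2 0 i * dy i (dy j L) z).
  by rewrite mulr_sumr; apply: eq_bigr => i _; rewrite mxE mulrCA.
congr (_ * _); rewrite (@euler _ _ oU 1) ?mul1r//.
  by apply: (homog_dy oU coneU); [exact: homog_sq|exact: Ck_sq].
by apply: Ck_derive; exact: Ck_sq.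
Qed.

(** Euler's identity for [L] is differentiated along y^i, whereas [metric_fibre_l] applies Euler's
    identity to [dy j L]. Comparing the two contractions will give the symmetry of the metric. *)
Lemma metric_fibre_r z i : U z ->
  \sum_j z.2 0 j * metric K z i j = 2^-1 * dy i L z.
Proof.
move=> Uz; transitivity (2^-1 * \sum_j z.2 0 j * dy i (dy j L) z).
  by rewrite mulr_sumr; apply: eq_bigr => j _; rewrite mxE mulrCA.
congr (_ * _).
have D f : Ck 1 U f -> is_derive z ((0, delta_mx 0 i) : V) f (dy i f z).
  by move=> Cf; exact: (Ck_is_derive _ Cf Uz).
have H1 : is_derive z ((0, delta_mx 0 i) : V) (fun w => \sum_j w.2 0 j * dy j L w)
    (\sum_j ((j == i)%:R * dy j L z + z.2 0 j * dy i (dy j L) z)).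
  apply: is_derive_bigsum => j; apply: is_derive_mul.
    have := is_derive_fibre_coord z ((0, delta_mx 0 i) : V) j.
    by rewrite /= mxE eqxx.
  by apply: D; apply: Ck_derive; exact: Ck_sq.
have H2 : is_derive z ((0, delta_mx 0 i) : V) (fun w => L w + L w)
    (dy i L z + dy i L z).
  by apply: is_derive_add; apply: D; exact: Ck_sq.
have E : {in U, (fun w : V => \sum_j w.2 0 j * dy j L w) =1 (fun w => L w + L w)}.
  move=> w /set_mem Uw; rewrite (euler oU homog_sq (Ck_sq _) Uw).
  by rewrite mulr_natl mulr2n.
have := @derive_val _ _ _ _ _ _ _ (eq_on_is_derive oU Uz E H1).
rewrite (@derive_val _ _ _ _ _ _ _ H2) => /esym.
rewrite big_split /= (bigD1 i) //= eqxx mul1r big1 ?addr0; last first.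
  by move=> j /negbTE ->; rewrite mul0r.
by move=> /addrI.
Qed.

End Regularity.

(** * The modified Berwald frame *)

Section FrameAlgebra.
Context {R : realFieldType}.
Implicit Types (y l m M a r : 'I_2 -> R) (g h : 'I_2 -> 'I_2 -> R).

(** By Cramer's rule [M] is [s / d] times [(- l 1, l 0)], with [d] the determinant of [g]: this
    gives orthogonality to [l] at once, and the rest through y^i l_i = F. *)
Lemma frame_algebra y l m M g (F s e : R) : F != 0 ->
  (forall j, \sum_i y i * g i j = F * l j) ->
  (forall i, \sum_j y j * g i j = F * l i) ->
  \sum_i y i * l i = F ->
  m 0 = - s * (y 1 / F) -> m 1 = s * (y 0 / F) ->
  (forall i, \sum_j g i j * M j = m i) ->
  g 0 0 * g 1 1 - g 0 1 * g 1 0 != 0 ->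
  s ^+ 2 = e * (g 0 0 * g 1 1 - g 0 1 * g 1 0) -> e ^+ 2 = 1 ->
  [/\ \sum_i l i * M i = 0, \sum_i m i * M i = e,
      forall i j, g i j = g j i & y 0 * M 1 - y 1 * M 0 != 0].
Proof.
move=> F0 yg gy; have := (gy 0, gy 1, yg 0, yg 1).
rewrite !sum_ord2 => -[[[gy0 gy1] yg0] yg1] yl m0 m1 gM.
have := (gM 0, gM 1); rewrite !sum_ord2 => -[gM0 gM1].
set d := _ - _ => d0 s2 e2.
(* Comparing [gy] with [yg] shows that [y 0] and [y 1] times the antisymmetric part vanish;
   contraction with [l] turns them into [F], which is nonzero. *)
have g10 : g 1 0 = g 0 1.
  apply/eqP; rewrite -subr_eq0 -(mulIr_eq0 _ (mulIf F0)) -yl.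
  have Y1 : y 1 * (g 1 0 - g 0 1) = 0 by lra.
  have Y0 : y 0 * (g 1 0 - g 0 1) = 0 by lra.
  apply/eqP; transitivity (y 0 * (g 1 0 - g 0 1) * l 0 + y 1 * (g 1 0 - g 0 1) * l 1).
    by ring.
  by rewrite Y0 Y1 !mul0r addr0.
have dM0 : d * M 0 = - s * l 1.
  transitivity (g 1 1 * m 0 - g 0 1 * m 1); first by rewrite -gM0 -gM1 /d; ring.
  rewrite m0 m1; transitivity (- s * ((y 0 * g 0 1 + y 1 * g 1 1) / F)); first by field.
  by rewrite yg1; field.
have dM1 : d * M 1 = s * l 0.
  transitivity (g 0 0 * m 1 - g 1 0 * m 0); first by rewrite -gM0 -gM1 /d; ring.
  rewrite m0 m1; transitivity (s * ((y 0 * g 0 0 + y 1 * g 1 0) / F)); first by field.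
  by rewrite yg0; field.
have s0 : s != 0.
  by rewrite -sqrf_eq0 s2 mulf_neq0// -sqrf_eq0 e2 oner_neq0.
split.
- apply: (mulfI d0); rewrite mulr0 mulrDr !(mulrCA d) dM0 dM1; ring.
- apply: (mulfI d0); rewrite mulrDr !(mulrCA d) dM0 dM1 m0 m1 (mulrC d) -s2.
  transitivity (s ^+ 2 * ((y 0 * l 0 + y 1 * l 1) / F)); first by field.
  by rewrite yl; field.
- by apply: ord2P; apply: ord2P.
- rewrite -(mulrI_eq0 _ (mulfI d0)) mulrBr !(mulrCA d) dM0 dM1.
  rewrite (_ : _ - _ = s * (y 0 * l 0 + y 1 * l 1)); last by ring.
  by rewrite yl mulf_neq0.
Qed.

(** The vectors [y] and [M] form a basis, so a covector that kills both is zero. *)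
Lemma frame_dual y M a : y 0 * M 1 - y 1 * M 0 != 0 ->
  \sum_i y i * a i = 0 -> \sum_i a i * M i = 0 -> forall i, a i = 0.
Proof.
rewrite !sum_ord2 => D0 ya aM; apply: ord2P; apply: (mulfI D0).
- transitivity ((y 0 * a 0 + y 1 * a 1) * M 1 - y 1 * (a 0 * M 0 + a 1 * M 1)).
    by ring.
  by rewrite ya aM; ring.
- transitivity (y 0 * (a 0 * M 0 + a 1 * M 1) - (y 0 * a 0 + y 1 * a 1) * M 0).
    by ring.
  by rewrite ya aM; ring.
Qed.

(* The Gram determinant of [g] on [(y, M)] is [det g] times the square of the
   determinant of [(y, M)]. *)
Lemma gram_neq0 y M g r (a b c : R) :
  (forall j, \sum_i y i * g i j = r j) -> (forall i, \sum_j y j * g i j = r i) ->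
  \sum_i y i * r i = a -> \sum_i r i * M i = b ->
  \sum_i \sum_j M i * M j * g i j = c -> a * c - b ^+ 2 != 0 ->
  g 0 0 * g 1 1 - g 0 1 * g 1 0 != 0.
Proof.
move=> yg gy; have := (gy 0, gy 1, yg 0, yg 1).
rewrite !sum_ord2 => -[[[gy0 gy1] yg0] yg1] <- <- <-.
apply: contra_neq => d0.
transitivity ((g 0 0 * g 1 1 - g 0 1 * g 1 0) * (y 0 * M 1 - y 1 * M 0) ^+ 2);
  last by rewrite d0 mul0r.
rewrite expr2 -{2}gy0 -{2}gy1 -yg0 -yg1; ring.
Qed.

(** The bracket is the shape of the changed metric in [metric_bar]; its terms in [l] disappear
    because l_i M^i = 0. *)
Lemma conformal_vertical_quadratic M a l h g (E F e p C : R) :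
  \sum_i l i * M i = 0 -> \sum_i a i * M i = p ->
  \sum_i \sum_j M i * M j * h i j = C ->
  \sum_i \sum_j M i * M j * g i j = e ->
  \sum_i \sum_j M i * M j *
    (E * (2 * F ^+ 2 * a i * a j + 2 * F * l i * a j + F ^+ 2 * h i j
          + 2 * F * a i * l j + g i j)) =
  E * (e + F ^+ 2 * C + 2 * F ^+ 2 * p ^+ 2).
Proof.
rewrite !sum_ord2 => lM <- <- <-.
have {}lM : l 1 * M 1 = - (l 0 * M 0) by lra.
transitivity (E * (2 * F ^+ 2 * (a 0 * M 0 + a 1 * M 1) ^+ 2
  + 4 * F * (l 0 * M 0 + l 1 * M 1) * (a 0 * M 0 + a 1 * M 1)
  + F ^+ 2 * (M 0 * M 0 * h 0 0 + M 0 * M 1 * h 0 1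
    + (M 1 * M 0 * h 1 0 + M 1 * M 1 * h 1 1))
  + (M 0 * M 0 * g 0 0 + M 0 * M 1 * g 0 1
    + (M 1 * M 0 * g 1 0 + M 1 * M 1 * g 1 1)))).
  by ring.
by rewrite lM; ring.
Qed.

(* Differentiating [g(M, M) = e] gives [F m_j (M.d) M^j = - I e]. *)
Lemma main_scalar_algebra m M g (dg : 'I_2 -> 'I_2 -> 'I_2 -> R)
    (dM : 'I_2 -> 'I_2 -> R)
    (F I e : R) :
  (forall i, \sum_j g i j * M j = m i) -> (forall i j, g i j = g j i) ->
  \sum_i m i * M i = e -> e ^+ 2 = 1 ->
  (forall j k i, F * (2^-1 * dg j k i) = I * m j * m k * m i) ->
  (forall i, \sum_j \sum_k (dM i j * g j k * M k + M j * dg j k i * M k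
                            + M j * g j k * dM i k) = 0) ->
  F * \sum_i \sum_j M i * m j * dM i j = - I * e.
Proof.
move=> gM sg mM e2 Fdg D0.
have D i : F * \sum_j m j * dM i j = - I * m i.
  have A : \sum_j \sum_k M j * (F * (2^-1 * dg j k i)) * M k = I * m i.
    transitivity (I * m i * (\sum_j m j * M j) ^+ 2); last by rewrite mM e2 mulr1.
    by rewrite !sum_ord2 !Fdg; ring.
  (* By symmetry of [g] the two sums containing [dM] coincide, so half of [D0] contains exactly one
     of them; the subtracted term is the contracted Cartan tensor [A]. *)
  transitivity (F * (2^-1 * \sum_j \sum_k (dM i j * g j k * M k
      + M j * dg j k i * M k + M j * g j k * dM i k))
    - \sum_j \sum_k M j * (F * (2^-1 * dg j k i)) * M k).
    by rewrite !sum_ord2 -!gM !sum_ord2 (sg 1 0); field.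
  by rewrite D0 A !mulr0 sub0r mulNr.
transitivity (\sum_i M i * (F * \sum_j m j * dM i j)).
  by rewrite !sum_ord2; ring.
transitivity (- I * \sum_i m i * M i); last by rewrite mM.
by rewrite mulr_sumr; apply: eq_bigr => i _; rewrite D; ring.
Qed.

End FrameAlgebra.

(** * The Berwald frame and the vertical derivatives of [phi] in one chart *)

Section Chart.
Context {R : realType}.
Local Notation V := (TV R).
Variable U : set V.
Hypothesis oU : open U.
Hypothesis coneU : forall z (t : R), 0 < t -> U z -> U (z.1, t *: z.2).
Variables F phi I : V -> R.
Hypothesis CF : forall n, Ck n U F.
Hypothesis hF : homog U 1 F.
Hypothesis uF : forall z, U z -> metric F z \in unitmx.
Hypothesis F0 : forall z, U z -> F z != 0.
Hypothesis hI : is_main_scalar U F I.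
Hypothesis Cphi : forall n, Ck n U phi.
Hypothesis hphi : homog U 0 phi.
Implicit Types (z v : V) (i j k : 'I_2).

Local Notation L := (fun w : V => F w ^+ 2).
Local Notation Fbar := (anisotropic_change F phi).
Local Notation Lbar := (fun w : V => anisotropic_change F phi w ^+ 2).
Local Notation ev i := ((0, delta_mx 0 i) : V).

Lemma is_derive_dy f z i : Ck 1 U f -> U z -> is_derive z (ev i) f (dy i f z).
Proof. by move=> Cf Uz; exact: (Ck_is_derive _ Cf Uz). Qed.

Lemma is_derive_sq (K : V -> R) z v a : is_derive z v K a ->
  is_derive z v (fun w => K w ^+ 2) (2 * K z * a).
Proof.
move=> Ka; rewrite (_ : 2 * K z * a = a * K z + K z * a); last by ring.
exact: is_derive_mul.
Qed.

Lemma dy_sq z i : U z -> dy i L z = 2 * F z * dy i F z.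
Proof.
move=> Uz.
exact: (@derive_val _ _ _ _ _ _ _ (is_derive_sq (is_derive_dy i (CF 1) Uz))).
Qed.

Lemma eps_sq z : U z -> eps F z ^+ 2 = 1.
Proof. by move=> Uz; rewrite /eps sqr_sg (det_metric_neq0 uF Uz). Qed.

Lemma eps_det_gt0 z : U z -> 0 < eps F z * \det (metric F z).
Proof. by move=> Uz; rewrite /eps -normrEsg normr_gt0 (det_metric_neq0 uF Uz). Qed.

Lemma is_derive_eps z v : U z -> is_derive z v (eps F) 0.
Proof.
move=> Uz; apply: is_derive_sg; last exact: (det_metric_neq0 uF Uz).
exact: Ck_continuous (Ck_det_metric oU CF 0) Uz.
Qed.

Lemma Ck_eps n : Ck n U (eps F).
Proof.
by apply: Ck_sg => //; [exact: (det_metric_neq0 uF)|exact: (Ck_det_metric oU CF 0)].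
Qed.

Lemma Ck_ell_up n i : Ck n U (ell_up F i).
Proof. by apply: CkM => //; [exact: Ck_fibre_coord|exact: CkV]. Qed.

Lemma Ck_m_lo n i : Ck n U (m_lo F i).
Proof.
have Cs : Ck n U (fun z => Num.sqrt (eps F z * \det (metric F z))).
  apply: Ck_sqrt => //; first exact: eps_det_gt0.
  by apply: CkM => //; [exact: Ck_eps|exact: Ck_det_metric].
rewrite /m_lo; case: (i == 0); apply: CkM => //; try exact: Ck_ell_up.
exact: CkN.
Qed.

Lemma Ck_m_up n i : Ck n U (m_up F i).
Proof.
apply: Ck_sum => // j; apply: CkM => //; last exact: Ck_m_lo.
exact: Ck_metric_inv.
Qed.

Lemma metric_m_up z i : U z -> \sum_j metric F z i j * m_up F j z = m_lo F i z.
Proof.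
move=> Uz; pose m : 'cV[R]_2 := \col_j m_lo F j z.
have E j : m_up F j z = (invmx (metric F z) *m m) j 0.
  by rewrite mxE; apply: eq_bigr => k _; rewrite [m _ _]mxE.
transitivity ((metric F z *m (invmx (metric F z) *m m)) i 0).
  by rewrite mxE; apply: eq_bigr => j _; rewrite E.
by rewrite mulKVmx ?uF// mxE.
Qed.

Lemma fibre_ell z : U z -> \sum_i z.2 0 i * dy i F z = F z.
Proof. by move=> Uz; rewrite (euler oU hF (CF 1) Uz) mul1r. Qed.

Lemma half_dy_sq z i : U z -> 2^-1 * dy i L z = F z * dy i F z.
Proof. by move=> Uz; rewrite dy_sq//; field. Qed.

Lemma frameP z : U z ->
  [/\ \sum_i dy i F z * m_up F i z = 0, \sum_i m_lo F i z * m_up F i z = eps F z,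
      forall i j, metric F z i j = metric F z j i &
      z.2 0 0 * m_up F 1 z - z.2 0 1 * m_up F 0 z != 0].
Proof.
move=> Uz.
apply: (@frame_algebra _ (fun i => z.2 0 i) (fun i => dy i F z)
  (fun i => m_lo F i z) (fun i => m_up F i z) (fun i j => metric F z i j)
  (F z) (Num.sqrt (eps F z * \det (metric F z))) (eps F z)) => //.
- exact: F0.
- by move=> j; rewrite (metric_fibre_l oU coneU CF hF)// half_dy_sq.
- by move=> j; rewrite (metric_fibre_r oU CF hF)// half_dy_sq.
- exact: fibre_ell.
- by move=> i; exact: metric_m_up.
- by rewrite -det2 (det_metric_neq0 uF).
- by rewrite -det2 sqr_sqrtr// ltW// eps_det_gt0.
- exact: eps_sq.
Qed.

Lemma fibre_phi z : U z -> \sum_i z.2 0 i * dy i phi z = 0.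
Proof. by move=> Uz; rewrite (euler oU hphi (Cphi 1) Uz) mul0r. Qed.

Lemma fibre_m_lo z : U z -> \sum_i z.2 0 i * m_lo F i z = 0.
Proof. by move=> Uz; rewrite sum_ord2 /m_lo /= /ell_up; field; exact: F0. Qed.

(** Degree 0 makes the fibre differential of [phi] kill y, as [m_lo] does, so the two are
    proportional; [eps], its own inverse, normalises m_i m^i. *)
Lemma dy_phi_m_lo z i : U z ->
  dy i phi z = (\sum_j dy j phi z * m_up F j z) * eps F z * m_lo F i z.
Proof.
move=> Uz; have [_ mM _ D0] := frameP Uz.
set p := \sum_j _; apply/eqP; rewrite -subr_eq0; apply/eqP.
apply: (@frame_dual _ (fun i => z.2 0 i) (fun i => m_up F i z)
  (fun i => dy i phi z - p * eps F z * m_lo F i z)) => //.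
- have -> : \sum_j z.2 0 j * (dy j phi z - p * eps F z * m_lo F j z) =
      \sum_j z.2 0 j * dy j phi z - p * eps F z * \sum_j z.2 0 j * m_lo F j z.
    by rewrite mulr_sumr -sumrB; apply: eq_bigr => j _; ring.
  by rewrite fibre_phi// fibre_m_lo// mulr0 subr0.
- have -> : \sum_j (dy j phi z - p * eps F z * m_lo F j z) * m_up F j z =
      p - p * eps F z * \sum_j m_lo F j z * m_up F j z.
    by rewrite mulr_sumr -sumrB; apply: eq_bigr => j _; ring.
  by rewrite mM -mulrA -expr2 eps_sq// mulr1 subrr.
Qed.

(** The relation g(m, m) = [eps] holds on [U] and [eps] has zero derivative, which is the input of
    [main_scalar_algebra]. *)
Lemma main_scalar_dy_m_up z : U z ->
  F z * \sum_i \sum_j m_up F i z * m_lo F j z * dy i (m_up F j) z = - I z * eps F z.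
Proof.
move=> Uz; have [_ mM sg _] := frameP Uz.
apply: (@main_scalar_algebra _ (fun i => m_lo F i z) (fun i => m_up F i z)
  (fun i j => metric F z i j) (fun j k i => dy i (fun w => metric F w j k) z)
  (fun i j => dy i (m_up F j) z)) => //.
- by move=> i; exact: metric_m_up.
- exact: eps_sq.
- by move=> j k i; exact: hI.
- move=> i.
  have E : {in U, (fun w : V => \sum_j \sum_k m_up F j w * metric F w j k * m_up F k w)
      =1 eps F}.
    move=> w /set_mem Uw; have [_ <- _ _] := frameP Uw; apply: eq_bigr => j _.
    rewrite -metric_m_up// mulr_suml; apply: eq_bigr => k _; ring.
  have D : is_derive z (ev i)
      (fun w : V => \sum_j \sum_k m_up F j w * metric F w j k * m_up F k w)
      (\sum_j \sum_k ((dy i (m_up F j) z * metric F z j k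
         + m_up F j z * dy i (fun w => metric F w j k) z) * m_up F k z
         + m_up F j z * metric F z j k * dy i (m_up F k) z)).
    apply: is_derive_bigsum => j; apply: is_derive_bigsum => k.
    apply: is_derive_mul; last by apply: is_derive_dy => //; exact: Ck_m_up.
    apply: is_derive_mul; apply: is_derive_dy => //; first exact: Ck_m_up.
    exact: Ck_metric.
  have := @derive_val _ _ _ _ _ _ _ (eq_on_is_derive oU Uz E D).
  rewrite (@derive_val _ _ _ _ _ _ _ (is_derive_eps _ Uz)) => D0; rewrite [RHS]D0.
  by apply: eq_bigr => j _; apply: eq_bigr => k _; ring.
Qed.

Lemma is_derive_semi2 z i : U z -> is_derive z (ev i) (semi2 F phi)
  (eps F z * dy i F z * (\sum_j dy j phi z * m_up F j z) + eps F z * F z *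
   \sum_j (dy i (dy j phi) z * m_up F j z + dy j phi z * dy i (m_up F j) z)).
Proof.
move=> Uz; apply: is_derive_mul.
  rewrite -[X in is_derive _ _ _ X]add0r -[X in X + _](mul0r (F z)).
  by apply: is_derive_mul; [exact: is_derive_eps|exact: is_derive_dy].
apply: is_derive_bigsum => j; apply: is_derive_mul; apply: is_derive_dy => //.
  exact: Ck_derive.
exact: Ck_m_up.
Qed.

Definition vertical_hessian z : R :=
  \sum_i \sum_j m_up F i z * m_up F j z * dy i (dy j phi) z.

(** The main scalar term of [sigma] compensates the derivative of the frame vector m, leaving the
    plain Hessian of [phi] on (m, m). *)
Lemma semi2_semi2 z : U z ->
  semi2 F (semi2 F phi) z + eps F z * I z * semi2 F phi z =
  F z ^+ 2 * vertical_hessian z.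
Proof.
move=> Uz; have [lM _ _ _] := frameP Uz.
set p := \sum_j dy j phi z * m_up F j z.
have phim j : dy j phi z = p * eps F z * m_lo F j z := dy_phi_m_lo j Uz.
have semiE : semi2 F phi z = eps F z * F z * p by [].
have dS i : dy i (semi2 F phi) z = eps F z * dy i F z * p + eps F z * F z *
    \sum_j (dy i (dy j phi) z * m_up F j z + dy j phi z * dy i (m_up F j) z) :=
  @derive_val _ _ _ _ _ _ _ (is_derive_semi2 i Uz).
move: p phim semiE dS => p phim semiE dS.
(* The three summands come from differentiating [F], [dy j phi] and [m_up F j]; the first is zero
   since l_i m^i = 0. *)
have E : \sum_i dy i (semi2 F phi) z * m_up F i z =
    eps F z * p * (\sum_i dy i F z * m_up F i z)
    + eps F z * F z * vertical_hessian z
    + eps F z * (p * eps F z) *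
      (F z * \sum_i \sum_j m_up F i z * m_lo F j z * dy i (m_up F j) z).
  rewrite /vertical_hessian !mulr_sumr -!big_split /=; apply: eq_bigr => i _.
  rewrite dS.
  have -> : \sum_j (dy i (dy j phi) z * m_up F j z + dy j phi z * dy i (m_up F j) z) =
     \sum_j dy i (dy j phi) z * m_up F j z +
     p * eps F z * \sum_j m_lo F j z * dy i (m_up F j) z.
    rewrite mulr_sumr -big_split; apply: eq_bigr => j _ /=.
    by rewrite phim; ring.
  have -> : \sum_j m_up F i z * m_up F j z * dy i (dy j phi) z =
      m_up F i z * \sum_j dy i (dy j phi) z * m_up F j z.
    by rewrite mulr_sumr; apply: eq_bigr => j _; ring.
  have -> : \sum_j m_up F i z * m_lo F j z * dy i (m_up F j) z =
      m_up F i z * \sum_j m_lo F j z * dy i (m_up F j) z.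
    by rewrite mulr_sumr; apply: eq_bigr => j _; ring.
  by ring.
rewrite semiE {1}/semi2 E lM main_scalar_dy_m_up//.
(* The two terms in [I z] meet in the factor [1 - eps F z ^+ 2], which is 0. *)
transitivity (eps F z ^+ 2 * F z ^+ 2 * vertical_hessian z
  + eps F z ^+ 2 * (1 - eps F z ^+ 2) * F z * p * I z); first by ring.
by rewrite eps_sq//; ring.
Qed.

(** * The metric of the changed function and its horizontal derivatives *)

Lemma Ck_bar n : Ck n U Fbar.
Proof. by apply: CkM => //; exact: Ck_expR. Qed.

Lemma homog_bar : homog U 1 Fbar.
Proof.
move=> z t t0 Uz; rewrite /anisotropic_change hF// hphi// expr0 mul1r.
by rewrite mulrCA.
Qed.

Lemma derive_Lbar z v : U z ->
  'D_v Lbar z = expR (phi z) ^+ 2 * (2 * F z ^+ 2 * 'D_v phi z + 'D_v L z).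
Proof.
move=> Uz; have DF := Ck_is_derive v (CF 1) Uz; have Dp := Ck_is_derive v (Cphi 1) Uz.
rewrite (@derive_val _ _ _ _ _ _ _ (is_derive_sq DF)).
have De := @is_derive_comp _ _ expR phi _ _ _ _ Dp (is_derive_expR (phi z)).
have DL : is_derive z v Lbar _ := is_derive_sq (is_derive_mul De DF).
rewrite (@derive_val _ _ _ _ _ _ _ DL) /anisotropic_change; ring.
Qed.

Lemma dy_dy_Lbar z i j : U z -> dy i (dy j Lbar) z =
  expR (phi z) ^+ 2 * (4 * F z ^+ 2 * dy i phi z * dy j phi z
    + 4 * F z * dy i F z * dy j phi z + 2 * F z ^+ 2 * dy i (dy j phi) z
    + 4 * F z * dy i phi z * dy j F z + dy i (dy j L) z).
Proof.
move=> Uz.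
have E : {in U, (fun w => expR (phi w) ^+ 2 * (2 * F w ^+ 2 * dy j phi w + dy j L w))
    =1 dy j Lbar}.
  by move=> w /set_mem Uw; rewrite [RHS]derive_Lbar.
have DF := is_derive_dy i (CF 1) Uz; have Dp := is_derive_dy i (Cphi 1) Uz.
have De := @is_derive_comp _ _ expR phi _ _ _ _ Dp (is_derive_expR (phi z)).
have D2 : is_derive z (ev i) (fun w => 2 * F w ^+ 2)
    (0 * F z ^+ 2 + 2 * (2 * F z * dy i F z)).
  by apply: is_derive_mul; exact: is_derive_sq.
have Djp : is_derive z (ev i) (dy j phi) (dy i (dy j phi) z) :=
  is_derive_dy i (Ck_derive (ev j) (Cphi 2)) Uz.
have DjL : is_derive z (ev i) (dy j L) (dy i (dy j L) z) :=
  is_derive_dy i (Ck_derive (ev j) (Ck_sq oU CF 2)) Uz.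
have D := is_derive_mul (is_derive_sq De) (is_derive_add (is_derive_mul D2 Djp) DjL).
have H := @derive_val _ _ _ _ _ _ _ (eq_on_is_derive oU Uz E D).
have ringE (E0 f pi pj pij li lj lij gj : R) : gj = 2 * f * lj ->
    2 * E0 * (E0 * pi) * (2 * f ^+ 2 * pj + gj)
    + E0 ^+ 2 * ((0 * f ^+ 2 + 2 * (2 * f * li)) * pj + 2 * f ^+ 2 * pij + lij) =
    E0 ^+ 2 * (4 * f ^+ 2 * pi * pj + 4 * f * li * pj + 2 * f ^+ 2 * pij
      + 4 * f * pi * lj + lij) by move=> ->; ring.
exact: etrans H (ringE _ _ _ _ _ _ _ _ _ (dy_sq j Uz)).
Qed.

Lemma metric_bar z i j : U z -> metric Fbar z i j =
  expR (phi z) ^+ 2 * (2 * F z ^+ 2 * dy i phi z * dy j phi z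
    + 2 * F z * dy i F z * dy j phi z + F z ^+ 2 * dy i (dy j phi) z
    + 2 * F z * dy i phi z * dy j F z + metric F z i j).
Proof.
move=> Uz; apply: etrans (metricE Fbar z i j) _.
apply: etrans (congr1 _ (dy_dy_Lbar i j Uz)) _; rewrite (metricE F z i j).
have ringE (E0 f pi pj pij li lj lij : R) :
    2^-1 * (E0 * (4 * f ^+ 2 * pi * pj + 4 * f * li * pj + 2 * f ^+ 2 * pij
      + 4 * f * pi * lj + lij)) =
    E0 * (2 * f ^+ 2 * pi * pj + 2 * f * li * pj + f ^+ 2 * pij
      + 2 * f * pi * lj + 2^-1 * lij) by field.
exact: ringE.
Qed.

Lemma metric_bar_unit z : U z ->
  sigma F I phi z + eps F z - semi2 F phi z ^+ 2 != 0 ->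
  metric Fbar z \in unitmx.
Proof.
move=> Uz nd; have [lM mM _ _] := frameP Uz.
pose p := \sum_j dy j phi z * m_up F j z.
(* The covector obtained by contracting the new metric with y, which by Euler is half the fibre
   differential of [Lbar]. *)
pose r i := expR (phi z) ^+ 2 * (F z ^+ 2 * dy i phi z + F z * dy i F z).
have rE i : 2^-1 * dy i Lbar z = r i.
  have dL : dy i Lbar z = expR (phi z) ^+ 2 *
    (2 * F z ^+ 2 * dy i phi z + dy i L z) := derive_Lbar (ev i) Uz.
  by rewrite dL dy_sq// /r; field.
rewrite unitmxE unitfE det2.
(* The last three arguments are the values of the new metric on (y, y), (y, m) and (m, m). *)
apply: (@gram_neq0 _ (fun i => z.2 0 i) (fun i => m_up F i z)
  (fun i j => metric Fbar z i j) r (expR (phi z) ^+ 2 * F z ^+ 2)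
  (expR (phi z) ^+ 2 * F z ^+ 2 * p)
  (expR (phi z) ^+ 2 *
    (eps F z + F z ^+ 2 * vertical_hessian z + 2 * F z ^+ 2 * p ^+ 2))).
- by move=> j; rewrite (metric_fibre_l oU coneU Ck_bar homog_bar).
- by move=> i; rewrite (metric_fibre_r oU Ck_bar homog_bar).
- transitivity (expR (phi z) ^+ 2 * (F z ^+ 2 * (\sum_i z.2 0 i * dy i phi z)
      + F z * (\sum_i z.2 0 i * dy i F z))).
    rewrite !mulr_sumr -big_split mulr_sumr; apply: eq_bigr => i _.
    by rewrite /r /=; ring.
  by rewrite fibre_phi// fibre_ell//; ring.
- transitivity (expR (phi z) ^+ 2 * (F z ^+ 2 * p
      + F z * (\sum_i dy i F z * m_up F i z))).
    rewrite !mulr_sumr -big_split mulr_sumr; apply: eq_bigr => i _.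
    by rewrite /r /=; ring.
  by rewrite lM; ring.
- have gMM : \sum_i \sum_j m_up F i z * m_up F j z * metric F z i j = eps F z.
    rewrite -mM; apply: eq_bigr => i _; rewrite -metric_m_up// mulr_suml.
    by apply: eq_bigr => j _; ring.
  have Q := @conformal_vertical_quadratic _ (fun i => m_up F i z)
    (fun i => dy i phi z) (fun i => dy i F z) (fun i j => dy i (dy j phi) z)
    (fun i j => metric F z i j) (expR (phi z) ^+ 2) (F z) (eps F z) p
    (vertical_hessian z) lM erefl erefl gMM.
  apply: etrans Q; apply: eq_bigr => i _; apply: eq_bigr => j _.
  exact: (congr1 (fun x => m_up F i z * m_up F j z * x) (metric_bar i j Uz)).
- have semiE : semi2 F phi z = eps F z * F z * p by [].
  move: nd; rewrite /sigma semi2_semi2// semiE => nd.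
  have sE : (eps F z * F z * p) ^+ 2 = F z ^+ 2 * p ^+ 2.
    by rewrite !exprMn eps_sq// mul1r.
  set a := _ - _.
  have -> : a = (expR (phi z) ^+ 2 * F z) ^+ 2 *
    (F z ^+ 2 * vertical_hessian z + 2 * (eps F z * F z * p) ^+ 2 + eps F z
     - (eps F z * F z * p) ^+ 2).
    by rewrite /a sE; ring.
  by rewrite mulf_neq0// expf_neq0// mulf_neq0 ?expf_neq0 ?F0// gt_eqF// expR_gt0.
Qed.

(** The operator delta_i is a derivation that kills [L] by [spray_horizontal], so only the
    exponential factor is differentiated. *)
Lemma delta_Lbar z i : U z ->
  dx i Lbar z - \sum_j connection F i j z * dy j Lbar z =
  expR (phi z) ^+ 2 * (2 * F z ^+ 2) * delta F i phi z.
Proof.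
move=> Uz; have H := spray_horizontal oU coneU CF hF uF i Uz.
have -> : \sum_j connection F i j z * dy j Lbar z = expR (phi z) ^+ 2 *
    (2 * F z ^+ 2 * (\sum_j connection F i j z * dy j phi z)
     + \sum_j connection F i j z * dy j L z).
  rewrite mulr_sumr -big_split mulr_sumr; apply: eq_bigr => j _.
  by rewrite {1}/dy derive_Lbar//= -!/(dy _ _ _); ring.
by rewrite -H /delta {1}/dx derive_Lbar// -!/(dx _ _ _); ring.
Qed.

(** * The two equivalences in one chart *)

Hypothesis nd : forall z, U z ->
  sigma F I phi z + eps F z - semi2 F phi z ^+ 2 != 0.

Lemma same_spray_coefP :
  (forall z, U z -> forall j, spray_coef Fbar j z = spray_coef F j z) <->
  (forall z, U z -> forall i, delta F i phi z = 0).
Proof.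
(* The Lagrangian is that of [Fbar], but the spray coefficients are those of [F]. *)
have [EH HE] := spray_equation_horizontal oU coneU (Ck_sq oU Ck_bar 2)
  (fun j => Ck_spray_coef oU CF uF 1 j) (homog_sq homog_bar)
  (homog_spray_coef oU coneU CF hF).
have uB z (Uz : U z) := metric_bar_unit Uz (nd Uz).
split=> H z Uz.
- move=> i; have := delta_Lbar i Uz.
  rewrite (EH _ z Uz i) ?subrr => [|w Uw]; last first.
    by apply: (spray_coefP _ (uB w Uw)).1; exact: H.
  move=> /esym/eqP; rewrite mulf_eq0 => /orP[|/eqP//].
  rewrite mulf_eq0 expf_eq0 /= gt_eqF ?expR_gt0// mulf_eq0 expf_eq0 /=.
  by rewrite (negbTE (F0 Uz)) pnatr_eq0.
- apply: (spray_coefP (spray_coef F) (uB z Uz)).2; apply: HE z Uz => w Uw i.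
  by have /eqP := delta_Lbar i Uw; rewrite H// mulr0 subr_eq0 => /eqP.
Qed.

Lemma comma1_eq0 z : U z -> comma1 F phi z = 0 ->
  \sum_i z.2 0 i * delta F i phi z = 0.
Proof.
move=> Uz c0; transitivity (F z * comma1 F phi z); last by rewrite c0 mulr0.
rewrite /comma1 mulr_sumr; apply: eq_bigr => i _.
by rewrite /ell_up; field; exact: F0.
Qed.

Lemma semi2_comma1_eq0 z : (forall w, U w -> comma1 F phi w = 0) -> U z ->
  semi2 F (comma1 F phi) z = 0.
Proof.
move=> c0 Uz; rewrite /semi2 big1 ?mulr0// => i _.
rewrite /dy (@eq_on_derive _ _ U oU _ (cst 0)) ?derive_cst ?mul0r//.
by move=> w /set_mem Uw; exact: c0.
Qed.

Lemma PQ_eq0P :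
  (forall z, U z -> Pcoef F I phi z = 0 /\ Qcoef F I phi z = 0) <->
  (forall z, U z -> forall i, delta F i phi z = 0).
Proof.
have e0 z : U z -> eps F z != 0.
  by move=> Uz; rewrite -sqrf_eq0 eps_sq// oner_neq0.
split=> H z Uz.
- have PQ0 w : U w -> PQ_factor F phi w = 0 /\ comma1 F phi w = 0.
    move=> Uw; have [P0 Q0] := H w Uw.
    have half0 : 2^-1 != 0 :> R by rewrite invr_eq0 pnatr_eq0.
    have F20 : F w ^+ 2 != 0 by rewrite expf_neq0// F0.
    have rho0 : rho F I phi w != 0 by rewrite /rho mul1r invr_neq0// nd.
    (* In [Qcoef] the factor has a nonzero coefficient; once it is zero, [Pcoef] reduces to F^2
       phi_,1 / 2. *)
    have PQ0 : PQ_factor F phi w = 0.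
      have k0 := mulf_neq0 half0 (mulf_neq0 (mulf_neq0 (e0 _ Uw) rho0) F20).
      by apply: (mulfI k0); rewrite mulr0 -Q0 /Qcoef !mulrA.
    split=> //; apply: (mulfI (mulf_neq0 half0 F20)).
    by rewrite mulr0 -[RHS]P0 /Pcoef PQ0 mulr0 add0r -mulrA.
  have c1 w (Uw : U w) := (PQ0 w Uw).2.
  have c2 : \sum_i delta F i phi z * m_up F i z = 0.
    (* As phi_,1 vanishes on all of [U], so does phi_,1;2, and the factor is reduced to - 2
       phi_,2. *)
    have [+ _] := PQ0 z Uz; rewrite /PQ_factor c1// semi2_comma1_eq0// mulr0 !add0r.
    move=> /eqP; rewrite oppr_eq0 mulf_eq0 pnatr_eq0 /= => /eqP c2.
    by apply: (mulfI (e0 _ Uz)); exact: etrans c2 (esym (mulr0 _)).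
  have [_ _ _ D0] := frameP Uz.
  exact: (@frame_dual _ (fun i => z.2 0 i) (fun i => m_up F i z)
    (fun i => delta F i phi z) D0 (comma1_eq0 Uz (c1 z Uz)) c2).
- have c1 w : U w -> comma1 F phi w = 0.
    by move=> Uw; rewrite /comma1 big1// => i _; rewrite H// mul0r.
  have PQ0 : PQ_factor F phi z = 0.
    rewrite /PQ_factor c1// semi2_comma1_eq0// /comma2 big1 => [|i _].
      by rewrite !mulr0 addr0 subr0.
    by rewrite H// mul0r.
  by rewrite /Pcoef /Qcoef PQ0 c1// !mulr0 addr0 mulr0.
Qed.

End Chart.

(** * From the charts to the surface *)

Lemma geodesic_sprayP (R : realType) (K F : TV R -> R) (z : TV R) :
  geodesic_spray K z = geodesic_spray F z <->
  forall j, spray_coef K j z = spray_coef F j z.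
Proof.
split=> [[/rowP E] j|E].
  by have := E j; rewrite !mxE => /mulfI; apply; rewrite oppr_eq0 pnatr_eq0.
by congr (_, _); apply/rowP => j; rewrite !mxE E.
Qed.

Theorem theorem3p11 (R : realType) (M : topologicalType)
    (X : smooth_surface R M) (A : chart X -> set (TV R))
    (F phi I : chart X -> TV R -> R)
    (hA : conic_subbundle A)
    (hF : conic_pseudo_Finsler A F)
    (hF0 : forall c z, A c z -> F c z != 0)
    (hI : forall c, is_main_scalar (A c) (F c) (I c))
    (hphi : smooth_fun A phi)
    (hphi0 : homogeneous 0 A phi)
    (hnd : forall c z, A c z ->
       sigma (F c) (I c) (phi c) z + eps (F c) z
         - semi2 (F c) (phi c) z ^+ 2 != 0) :
  let same_spray := forall c z, A c z ->
    geodesic_spray (anisotropic_change (F c) (phi c)) z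
      = geodesic_spray (F c) z in
  let PQ_zero := forall c z, A c z ->
    Pcoef (F c) (I c) (phi c) z = 0 /\ Qcoef (F c) (I c) (phi c) z = 0 in
  let horizontally_constant := forall c z, A c z ->
    forall i, delta (F c) i (phi c) z = 0 in
  (same_spray <-> PQ_zero) /\ (same_spray <-> horizontally_constant).
Proof.
move=> same_spray PQ_zero horizontally_constant.
case: hA => _ [_ oA] _ _ coneA; case: hF => -[_ sF] h1F uF; case: hphi => _ sphi.
have CF c n : Ck n (A c) (F c) by exact: smooth_on_Ck.
have Cphi c n : Ck n (A c) (phi c) by exact: smooth_on_Ck.
have spray_iff : same_spray <-> horizontally_constant.
  have S c := same_spray_coefP (oA c) (fun z t => coneA c z t) (CF c)
    (fun z t => h1F c z t) (uF c) (hF0 c) (hI c) (Cphi c)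
    (fun z t => hphi0 c z t) (hnd c).
  split=> H c.
  - by apply: (S c).1 => z Az; apply/geodesic_sprayP; exact: H.
  - by move=> z Az; apply/geodesic_sprayP; apply: (S c).2 z Az; exact: H.
have PQ_iff : PQ_zero <-> horizontally_constant.
  have S c := PQ_eq0P (oA c) (fun z t => coneA c z t) (CF c)
    (fun z t => h1F c z t) (uF c) (hF0 c) (hnd c).
  by split=> H c; [apply: (S c).1|apply: (S c).2]; exact: H.
by split=> //; apply: iff_trans spray_iff (iff_sym PQ_iff).
Qed.
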